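(* The presentation complex $X$ of the presentation $\langle a,b \mid ab^2ab^{-1},\ bab^{-1}a^{-2}\rangle$ is contractible and does not have weak non-positive immersions.
   Context: All complexes are CW-complexes and all morphisms of complexes are assumed to be combinatorial, i.e. they send $n$-cells homeomorphically to $n$-cells. The presentation complex of a group presentation is the 2-complex with one vertex, one edge for each generator, and one 2-cell for each relator, attached along the loop spelling that relator. A map $Y\to X$ of CW-complexes is an immersion, written $Y\looparrowright X$, if it is locally injective. $\chi$ denotes the Euler characteristic. A 2-complex $X$ has weak non-positive immersions (WNPI) if $\chi(Y)\le 1$ for every immersion $Y\looparrowright X$ of a compact, connected 2-complex $Y$ into $X$. *)

(* Defs.v *)
From HB Require Import structures.
From mathcomp Require Import all_boot all_order all_algebra finmap.
From mathcomp Require Import all_classical all_reals all_analysis.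
From mathcomp Require Import lra.
Import Order.TTheory GRing.Theory Num.Theory.
Import numFieldNormedType.Exports.

Set Implicit Arguments.
Unset Strict Implicit.
Unset Printing Implicit Defensive.

Local Open Scope classical_set_scope.
Local Open Scope ring_scope.

Section homotopy.
Variable R : realType.

Definition homotopic (T U : topologicalType) (f g : T -> U) :=
  exists H : T * R -> U,
    [/\ {within [set: T] `*` `[0, 1], continuous H},
        forall x, H (x, 0) = f x & forall x, H (x, 1) = g x].

Definition contractible (T : topologicalType) :=
  exists x0 : T, homotopic (@id T) (cst x0).

End homotopy.

Definition homeomorphism_between (T U : topologicalType) (f : T -> U)
    (A : set T) (B : set U) :=
  [/\ set_bij A B f, {within A, continuous f} &
      exists2 g : U -> T, {within B, continuous g} & {in A, cancel f g}].

Definition locally_injective (T U : topologicalType) (f : T -> U) :=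
  forall x : T, exists2 A : set T, nbhs x A & set_inj A f.

Section disk.
Variable R : realType.

Definition sqnorm (p : R * R) : R := p.1 ^+ 2 + p.2 ^+ 2.
Definition disk : set (R * R) := [set p | sqnorm p <= 1].
Definition circle : set (R * R) := [set p | sqnorm p = 1].

Definition open_interval := {t : R | 0 < t < 1}.
Definition open_disk := {p : R * R | sqnorm p < 1}.

Definition circle_param (t : R) : R * R := (cos (2 * pi * t), sin (2 * pi * t)).

(* The inverse of circle_param : [0, 1[ -> circle; see circle_paramK. *)
Definition turn (p : R * R) : R :=
  (if 0 <= p.2 then acos p.1 else 2 * pi - acos p.1) / (2 * pi).

End disk.

(* CW-complexes of dimension at most 2, as gluing data. The realization of a  *)
(* complex has the disjoint union of its open cells as underlying set, and    *)
(* the final topology for the characteristic maps of its closed cells: this   *)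
(* is the space obtained by successive attachment of cells.                   *)

Record graph := Graph {
  vertices : choiceType;
  edges : choiceType;
  src : edges -> vertices;
  tgt : edges -> vertices
}.

Section graph_realization.
Variables (R : realType) (G : graph).

Variant gpoint :=
  | Vertex of vertices G
  | InEdge of edges G & open_interval R.

HB.instance Definition _ := gen_eqMixin gpoint.
HB.instance Definition _ := gen_choiceMixin gpoint.

(* Only its values on [0, 1] matter. *)
Definition char_edge (e : edges G) (t : R) : gpoint :=
  if insub t is Some s then InEdge e s
  else Vertex (if t <= 0 then src e else tgt e).

Definition gpoint_op : set_system gpoint :=
  [set U | forall e, open (char_edge e @^-1` U : set (subspace `[0, 1]))].

Let gpoint_opT : gpoint_op setT.
Proof. by move=> e; rewrite preimage_setT; exact: openT. Qed.

Let gpoint_opI : setI_closed gpoint_op.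
Proof. by move=> A B oA oB e; rewrite preimage_setI; exact: openI. Qed.

Let gpoint_op_bigU (I : Type) (f : I -> set gpoint) :
  (forall i, gpoint_op (f i)) -> gpoint_op (\bigcup_i f i).
Proof.
by move=> of_ e; rewrite preimage_bigcup; apply: bigcup_open => i _; exact: of_.
Qed.

HB.instance Definition _ :=
  isOpenTopological.Build gpoint gpoint_opT gpoint_opI gpoint_op_bigU.

End graph_realization.

Record complex (R : realType) := Complex {
  skeleton1 : graph;
  faces : choiceType;
  attach : faces -> R * R -> gpoint R skeleton1;
  attach_continuous : forall f, {within @circle R, continuous (attach f)}
}.

Section complex_realization.
Variables (R : realType) (X : complex R).

Variant point :=
  | Skeleton of gpoint R (skeleton1 X)
  | InFace of faces X & open_disk R.

HB.instance Definition _ := gen_eqMixin point.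
HB.instance Definition _ := gen_choiceMixin point.

(* Only its values on the closed disk matter. *)
Definition char_face (f : faces X) (p : R * R) : point :=
  if insub p is Some q then InFace f q else Skeleton (attach f p).

Definition point_op : set_system point :=
  [set U | open (Skeleton @^-1` U) /\
     forall f, open (char_face f @^-1` U : set (subspace (@disk R)))].

Let point_opT : point_op setT.
Proof. by split=> [|f]; rewrite preimage_setT; exact: openT. Qed.

Let point_opI : setI_closed point_op.
Proof.
by move=> A B [oA oA'] [oB oB']; split=> [|f]; rewrite preimage_setI;
  exact: openI.
Qed.

Let point_op_bigU (I : Type) (f : I -> set point) :
  (forall i, point_op (f i)) -> point_op (\bigcup_i f i).
Proof.
move=> of_; split=> [|e]; rewrite preimage_bigcup; apply: bigcup_open => i _;
  by have [] := of_ i.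
Qed.

HB.instance Definition _ :=
  isOpenTopological.Build point point_opT point_opI point_op_bigU.

Definition realization : topologicalType := point.

Variant cell :=
  | Cell0 of vertices (skeleton1 X)
  | Cell1 of edges (skeleton1 X)
  | Cell2 of faces X.

Definition dim (c : cell) : nat :=
  match c with Cell0 _ => 0 | Cell1 _ => 1 | Cell2 _ => 2 end.

Definition open_cell (c : cell) : set realization :=
  match c with
  | Cell0 v => [set Skeleton (Vertex R v)]
  | Cell1 e => range (fun t => Skeleton (InEdge e t))
  | Cell2 f => range (InFace f)
  end.

(* Junk value if X has infinitely many cells, since fset_set A is empty for   *)
(* an infinite set A; only used for compact, hence finite, complexes.         *)
Definition euler_char : int :=
  #|` fset_set [set: vertices (skeleton1 X)] |%:Z
  - #|` fset_set [set: edges (skeleton1 X)] |%:Z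
  + #|` fset_set [set: faces X] |%:Z.

End complex_realization.

Coercion realization : complex >-> topologicalType.

Section immersion.
Variable R : realType.

Definition combinatorial (Y X : complex R) (f : Y -> X) :=
  continuous f /\
  forall c : cell Y, exists2 d : cell X,
    dim d = dim c & homeomorphism_between f (open_cell c) (open_cell d).

Definition immersion (Y X : complex R) (f : Y -> X) :=
  combinatorial f /\ locally_injective f.

Definition weak_nonpositive_immersions (X : complex R) :=
  forall (Y : complex R) (f : Y -> X),
    compact [set: Y] -> connected [set: Y] -> immersion f ->
    euler_char Y <= 1.

End immersion.

(* The letter (g, false) stands for the generator g, and (g, true) for its    *)
(* inverse.                                                                   *)
Definition word (G : Type) := seq (G * bool).

Definition gen (G : Type) (g : G) : G * bool := (g, false).
Definition inv_gen (G : Type) (g : G) : G * bool := (g, true).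

Definition rose (G : choiceType) : graph :=
  @Graph unit G (fun=> tt) (fun=> tt).

Section spell.
Variables (R : realType) (G : choiceType).

Definition letter_path (l : G * bool) (t : R) : gpoint R (rose G) :=
  @char_edge R (rose G) l.1 (if l.2 then 1 - t else t).

(* The path parametrized by [0, size w] that runs along the i-th letter of w  *)
(* during the time interval [i, i + 1].                                       *)
Fixpoint spell (w : word G) (t : R) : gpoint R (rose G) :=
  if w is l :: w' then
    if t <= 1 then letter_path l t else spell w' (t - 1)
  else Vertex R (tt : vertices (rose G)).

Definition spell_circle (w : word G) (p : R * R) : gpoint R (rose G) :=
  spell w ((size w)%:R * turn p).

End spell.

Section turn_theory.
Variable R : realType.
Implicit Types (t : R) (p : R * R).

Lemma circle_paramE t : circle (circle_param t).
Proof. by rewrite /circle /sqnorm /= cos2Dsin2. Qed.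

Lemma circle_param_turn p : circle p -> circle_param (turn p) = p.
Proof.
case: p => x y; rewrite /circle /sqnorm /= => xy1.
have x1 : -1 <= x <= 1.
  rewrite -ler_norml -(@ler_pXn2r _ 2)// ?nnegrE// expr1n real_normK ?num_real//.
  by rewrite -xy1 lerDl sqr_ge0.
have pi0 : 2 * pi != 0 :> R by rewrite mulf_neq0// gt_eqF// pi_gt0.
rewrite /circle_param /turn /= mulrC divfK//.
have s2 : Num.sqrt (1 - x ^+ 2) = `|y| by rewrite -xy1 addrC addKr sqrtr_sqr.
case: ifPn => [y0|]; first by rewrite acosK ?in_itv// sin_acos// s2 ger0_norm.
rewrite -ltNge => y0.
rewrite (_ : 2 * pi = pi *+ 2); last by rewrite mulr_natl.
rewrite [_ - _]addrC cosD2pi sinD2pi cosN sinN acosK ?in_itv// sin_acos// s2.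
by rewrite ltr0_norm// opprK.
Qed.

Lemma turn_itv p : circle p -> 0 <= turn p < 1.
Proof.
case: p => x y; rewrite /circle /sqnorm /= => xy1.
have x1 : -1 <= x <= 1.
  rewrite -ler_norml -(@ler_pXn2r _ 2)// ?nnegrE// expr1n real_normK ?num_real//.
  by rewrite -xy1 lerDl sqr_ge0.
have pi0 := @pi_gt0 R.
have pi20 : 0 < 2 * pi :> R by rewrite mulr_gt0.
have a0 := acos_ge0 x1; have api := acos_lepi x1.
rewrite /turn /= ler_pdivlMr// ltr_pdivrMr// mul0r mul1r.
case: ifPn => y0; first by apply/andP; split; lra.
have xN1 : x < 1.
  rewrite lt_neqAle; case/andP: x1 => _ ->; rewrite andbT.
  apply/eqP => x1; move: y0; rewrite -ltNge => y0.
  move: xy1; rewrite x1 expr1n => /eqP; rewrite -subr_eq0 addrAC subrr add0r.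
  by rewrite sqrf_eq0 => /eqP y00; move: y0; rewrite y00 ltxx.
have := @acos_gt0 _ x; case/andP: x1 => -> _; rewrite xN1 => /(_ isT) ac.
by apply/andP; split; lra.
Qed.

Lemma circle_paramK t : 0 <= t < 1 -> turn (circle_param t) = t.
Proof.
case/andP=> t0 t1; have pi0 := @pi_gt0 R.
have pi20 : 2 * pi != 0 :> R by rewrite mulf_neq0// gt_eqF.
apply: (mulIf pi20); rewrite /turn /= divfK// [t * _]mulrC.
have t0' : 0 <= 2 * pi * t by rewrite !mulr_ge0// ltW.
have t1' : 2 * pi * t < 2 * pi by rewrite gtr_pMr ?mulr_gt0.
set s := 2 * pi * t in t0' t1' *.
have [spi|spi] := leP s pi.
  by rewrite sin_ge0_pi ?t0'// cosK// in_itv/= t0'.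
have eN : 2 * pi - s = - s + pi *+ 2 by rewrite -[pi *+ 2]mulr_natl addrC.
have es : sin s = - sin (2 * pi - s) by rewrite eN sinD2pi sinN opprK.
have ec : cos s = cos (2 * pi - s) by rewrite eN cosD2pi cosN.
have sp : 0 < sin (2 * pi - s) by apply: sin_gt0_pi; apply/andP; split; lra.
rewrite es oppr_ge0 leNgt sp /= ec cosK; first by rewrite opprB addrC subrK.
by rewrite in_itv /=; apply/andP; split; lra.
Qed.

Lemma turn_circle_param1 : turn (circle_param (1 : R)) = 0.
Proof.
rewrite -[RHS]circle_paramK ?lexx ?ltr01//; congr turn.
rewrite /circle_param mulr1 mulr0 cos0 sin0 [2 * _]mulr_natl.
by rewrite cos2pi sin2pi.
Qed.

Lemma circle_param_continuous : continuous (@circle_param R).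
Proof.
have mc : continuous (fun t : R => 2 * pi * t) by exact: mulrl_continuous.
have cc : continuous (fun t : R => cos (2 * pi * t)).
  by move=> t; apply: continuous_comp; [exact: mc|exact: continuous_cos].
have sc : continuous (fun t : R => sin (2 * pi * t)).
  by move=> t; apply: continuous_comp; [exact: mc|exact: continuous_sin].
by move=> t; exact: cvg_pair (cc t) (sc t).
Qed.

Lemma loop_turn_continuous (T : topologicalType) (g : R -> T) :
  {within `[0, 1], continuous g} -> g 0 = g 1 ->
  {within @circle R, continuous (g \o @turn R)}.
Proof.
move=> gc g01; apply/continuous_closedP => C cC; apply/closed_subspaceP.
have /continuous_closedP/(_ _ cC)/closed_subspaceP[W cW WC] := gc.
exists (@circle_param R @` (`[0, 1] `&` W)).
  apply: (@compact_closed (R^o * R^o)%type); first exact: norm_hausdorff.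
  apply: (@continuous_compact R).
    exact: continuous_subspaceT circle_param_continuous.
  by apply: compact_closedI => //; exact: segment_compact.
have WE t : `[0, 1]%classic t -> W t = C (g t).
  move=> t01; have := congr1 (fun A => A t) WC; rewrite /setI /= => WCt.
  apply/propext; split=> Ht.
    by have [] : C (g t) /\ t \in `[0, 1] by rewrite -WCt.
  by have [] : W t /\ t \in `[0, 1] by rewrite WCt.
rewrite /from_subspace eqEsubset; split=> [p [[t [t01 Wt] <-] cp]|p [Cp cp]]; split=> //=.
  move: Wt; rewrite WE// => Cgt; rewrite /preimage /from_subspace /=.
  move: (t01); rewrite /= in_itv/= => /andP[t0].
  rewrite le_eqVlt => /predU1P[t1|t1].
    by move: Cgt; rewrite t1 turn_circle_param1 g01.
  by rewrite circle_paramK// t0.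
exists (turn p); last exact: circle_param_turn.
have /andP[p0 p1] := turn_itv cp.
have p01 : `[0, 1]%classic (turn p) by rewrite /= in_itv/= p0 ltW.
by split=> //; rewrite WE.
Qed.

End turn_theory.

Section spell_theory.
Variables (R : realType) (G : choiceType).

Lemma char_edge_src (H : graph) (e : edges H) (t : R) :
  t <= 0 -> char_edge e t = Vertex R (src e).
Proof.
move=> t0; rewrite /char_edge insubF ?t0//.
by apply/negP => /andP[/lt_le_trans/(_ t0)]; rewrite ltxx.
Qed.

Lemma char_edge_tgt (H : graph) (e : edges H) (t : R) :
  1 <= t -> char_edge e t = Vertex R (tgt e).
Proof.
move=> t1; rewrite /char_edge insubF.
  by rewrite leNgt (lt_le_trans ltr01 t1).
by apply/negP => /andP[_ /(le_lt_trans t1)]; rewrite ltxx.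
Qed.

Lemma char_edge_continuous (H : graph) (e : edges H) :
  continuous (@char_edge R H e).
Proof.
pose clamp (t : R) : R := Num.min 1 (Num.max 0 t).
have clampE : @char_edge R H e = char_edge e \o clamp.
  apply/funext => t /=; rewrite /clamp; have [t0|t0] := leP t 0.
    by rewrite min_r ?ler01// !char_edge_src.
  by have [t1|//] := leP 1 t; rewrite !char_edge_tgt.
have clamp_cont : continuous clamp.
  move=> t; apply: (@continuous_min R R (fun=> 1) (fun t => Num.max 0 t)).
    exact: cst_continuous.
  apply: (@continuous_max R R (fun=> 0) id); first exact: cst_continuous.
  by move=> ?; exact: cvg_id.
apply/continuousP => U oU.
have /open_subspaceP[V oV VU] := oU e.
rewrite (_ : _ @^-1` U = clamp @^-1` V).
  by move/continuousP: clamp_cont; exact.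
apply/seteqP; split => t; rewrite {1}clampE /=.
  move=> Ut; have : (char_edge e @^-1` U `&` `[0, 1]) (clamp t).
    split=> //=; rewrite in_itv /= /clamp le_min ler01 le_max lexx /=.
    by rewrite ge_min lexx.
  by rewrite -VU => -[].
move=> Vt; suff : (char_edge e @^-1` U `&` `[0, 1]) (clamp t) by case.
rewrite -VU; split=> //=; rewrite in_itv /= /clamp le_min ler01 le_max lexx /=.
by rewrite ge_min lexx.
Qed.

Lemma letter_path_out (l : G * bool) (t : R) :
  (t <= 0) || (1 <= t) -> letter_path l t = Vertex R (tt : vertices (rose G)).
Proof.
rewrite /letter_path; case: l.2 => /orP[t0|t1];
  by [rewrite char_edge_src ?subr_le0|rewrite char_edge_tgt// lerBrDl gerDr].
Qed.

Lemma letter_path_continuous (l : G * bool) : continuous (@letter_path R G l).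
Proof.
move=> t; rewrite /letter_path; case: l.2; last exact: char_edge_continuous.
apply: (@continuous_comp _ _ _ (fun t : R => 1 - t)).
  by apply: (@continuousB _ R^o); [exact: cst_continuous|move=> ?; exact: cvg_id].
exact: char_edge_continuous.
Qed.

Lemma spell0 (w : word G) (t : R) :
  t <= 0 -> spell w t = Vertex R (tt : vertices (rose G)).
Proof.
case: w => [//|l w] t0 /=.
by rewrite (le_trans t0 ler01) letter_path_out ?t0.
Qed.

Lemma spell_size (w : word G) (t : R) :
  (size w)%:R <= t -> spell w t = Vertex R (tt : vertices (rose G)).
Proof.
elim: w t => [//|l w IHw] t /=; rewrite -add1n natrD => wt; case: ifPn => t1.
  by rewrite letter_path_out// (le_trans _ wt) ?orbT// lerDl.
by apply: IHw; rewrite lerBrDl.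
Qed.

Lemma spell_continuous (w : word G) : continuous (@spell R G w).
Proof.
elim: w => [|l w IHw]; first by move=> t; exact: cst_continuous.
have -> : @spell R G (l :: w) =
    (fun t => if t <= 1 then letter_path l t else spell w (t - 1)) by [].
set h := fun t : R => _.
have hT : {within `]-oo, 1] `|` `[1, +oo[, continuous h}.
  apply: withinU_continuous; [exact: lray_closed|exact: rray_closed| |].
    have lc : {within `]-oo, 1], continuous (@letter_path R G l)}.
      exact: continuous_subspaceT (@letter_path_continuous l).
    apply: subspace_eq_continuous lc => t; rewrite inE /= in_itv /=.
    by rewrite /from_subspace /h => ->.
  have sc : {within `[1, +oo[, continuous (fun t => @spell R G w (t - 1))}.
    apply: continuous_subspaceT => t.
    apply: (@continuous_comp _ _ _ (fun t : R => t - 1)); last exact: IHw.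
    by apply: (@continuousB _ R^o) => //; exact: cst_continuous.
  apply: subspace_eq_continuous sc => t; rewrite inE /= in_itv /= andbT.
  rewrite /from_subspace /h => t1; case: ifPn => // t1'.
  by rewrite letter_path_out ?t1 ?orbT// spell0// subr_le0.
have hE : `]-oo, 1] `|` `[1, +oo[ = [set: R].
  apply/seteqP; split=> // t _ /=; rewrite !in_itv /= andbT.
  by apply/orP; exact: le_total.
move: hT; rewrite hE => hT t; have := hT t.
by rewrite /continuous_at nbhs_subspaceT.
Qed.

Lemma spell_circle_continuous (w : word G) :
  {within @circle R, continuous (@spell_circle R G w)}.
Proof.
apply: (@loop_turn_continuous R _ (fun t => spell w ((size w)%:R * t))).
  apply: continuous_subspaceT => t; apply: continuous_comp.
    exact: mulrl_continuous.
  exact: spell_continuous.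
by rewrite mulr0 mulr1 spell0// spell_size.
Qed.

End spell_theory.

Definition presentation_complex (R : realType) (G : choiceType)
    (rels : seq (word G)) : complex R :=
  @Complex R (rose G) 'I_(size rels)
    (fun i => spell_circle (tnth (in_tuple rels) i))
    (fun i => @spell_circle_continuous R G (tnth (in_tuple rels) i)).

(* Main.v *)
Require Import Defs.
From mathcomp Require Import all_boot all_order all_algebra finmap.
From mathcomp Require Import all_classical all_reals all_analysis.
From mathcomp Require Import ring lra.
Import Order.TTheory GRing.Theory Num.Theory.
Import numFieldNormedType.Exports.

(** Capital letters stand for inverses: the relators are abbaB and baBAA.

    Contractibility. Attaching a disk to a space along two homotopic loops
    gives homotopy equivalent spaces, so a relator may be replaced by any word
    whose loop is homotopic to it in the complex of the other relators
    ([null_homotopic_id_slide], [null_homotopic_id_relator]). Inserting Aa twice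
    turns abbaB into ab(baBAA)aa, which the second relator reduces to abaa.
    Conversely abaa yields baa = A and B = aaa, hence baBAA = baa = A. Finally
    the relator A reduces abaa to b. The complex is thus homotopy equivalent to
    that of the relators b and A, a wedge of two disks, which is contracted
    along straight lines towards the base point
    ([null_homotopic_id_one_letter]).

    Failure of weak non-positive immersions. Let a and b act on four points by
    the cycles (0 1 2 3) and (1 2 3). Then abbaB acts trivially, while baBAA
    fixes the points 2 and 3 only. The covering of the rose defined by this
    action has 4 vertices and 8 edges; six lifts of the relators close up, and
    attaching them gives a finite connected complex of Euler characteristic
    4 - 8 + 6 = 2. It is immersed because two lifts of a relator that meet over
    the same point of its boundary start at the same vertex
    ([cover_map_immersion]). *)

Set Implicit Arguments.
Unset Strict Implicit.
Unset Printing Implicit Defensive.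

Local Open Scope classical_set_scope.
Local Open Scope ring_scope.

(** * Continuity of piecewise functions *)

Lemma continuous_if_le (R : realType) (T Z : topologicalType) (p : T -> R)
    (f g : T -> Z) :
  continuous p -> continuous f -> continuous g ->
  (forall x, p x = 0 -> f x = g x) ->
  continuous (fun x => if p x <= 0 then f x else g x).
Proof.
move=> pc fc gc fg; set h := fun x => _.
have hT : {within (p @^-1` `]-oo, 0]) `|` (p @^-1` `[0, +oo[), continuous h}.
  apply: withinU_continuous.
  - by apply: (preimage_closed (fun x _ => pc x)); exact: lray_closed.
  - by apply: (preimage_closed (fun x _ => pc x)); exact: rray_closed.
  - apply: subspace_eq_continuous (continuous_subspaceT fc) => x.
    by rewrite inE /= in_itv /= /from_subspace /h => ->.
  - apply: subspace_eq_continuous (continuous_subspaceT gc) => x.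
    rewrite inE /= in_itv /= andbT /from_subspace /h => p0.
    by case: ifPn => // p0'; rewrite fg//; apply/eqP; rewrite eq_le p0 p0'.
have hE : (p @^-1` `]-oo, 0]) `|` (p @^-1` `[0, +oo[) = [set: T].
  apply/seteqP; split=> // t _ /=; rewrite !in_itv /= andbT.
  by apply/orP; exact: le_total.
move: hT; rewrite hE => hT t.
by have := hT t; rewrite /continuous_at nbhs_subspaceT.
Qed.

Lemma continuous_pair_fun (T U V : topologicalType) (f : T -> U) (g : T -> V) :
  continuous f -> continuous g -> continuous (fun x => (f x, g x)).
Proof. by move=> fc gc x; exact: cvg_pair (fc x) (gc x). Qed.

Lemma continuous_comp_fun (T U V : topologicalType) (f : T -> U) (g : U -> V) :
  continuous f -> continuous g -> continuous (fun x => g (f x)).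
Proof. by move=> fc gc x; exact: continuous_comp (fc x) (gc (f x)). Qed.

Section real_functions.
Variables (R : realType) (T : topologicalType).
Implicit Types f g : T -> R.

Lemma continuous_add_fun f g : continuous f -> continuous g ->
  continuous (fun x => f x + g x).
Proof. by move=> fc gc x; apply: (@continuousD _ R^o); [exact: fc|exact: gc]. Qed.

Lemma continuous_sub_fun f g : continuous f -> continuous g ->
  continuous (fun x => f x - g x).
Proof. by move=> fc gc x; apply: (@continuousB _ R^o); [exact: fc|exact: gc]. Qed.

Lemma continuous_mul_fun f g : continuous f -> continuous g ->
  continuous (fun x => f x * g x).
Proof. by move=> fc gc x; apply: (@continuousM R); [exact: fc|exact: gc]. Qed.

Lemma continuous_max_fun f g : continuous f -> continuous g ->
  continuous (fun x => Num.max (f x) (g x)).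
Proof. by move=> fc gc x; apply: continuous_max; [exact: fc|exact: gc]. Qed.

Lemma continuous_min_fun f g : continuous f -> continuous g ->
  continuous (fun x => Num.min (f x) (g x)).
Proof. by move=> fc gc x; apply: continuous_min; [exact: fc|exact: gc]. Qed.

End real_functions.

Lemma continuous_fst (U V : topologicalType) : continuous (@fst U V).
Proof. by move=> x; exact: cvg_fst. Qed.
Lemma continuous_snd (U V : topologicalType) : continuous (@snd U V).
Proof. by move=> x; exact: cvg_snd. Qed.
Lemma continuous_id (U : topologicalType) : continuous (fun x : U => x).
Proof. by move=> x; exact: cvg_id. Qed.
Lemma continuous_const (U V : topologicalType) (v : V) : continuous (fun _ : U => v).
Proof. by move=> x; exact: cvg_cst. Qed.

(** Syntax directed, because unification alone would have to guess how to split
    a function into a composition. *)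
Ltac cont :=
  lazymatch goal with
  | |- continuous (fun x => x) => exact: continuous_id
  | |- continuous (fun _ => ?c) => exact: continuous_const
  | |- continuous (fun x => fst x) => exact: continuous_fst
  | |- continuous (fun x => snd x) => exact: continuous_snd
  | |- continuous (fun x => (@?f x, @?g x)) =>
      apply: (continuous_pair_fun (f := f) (g := g)); cont
  | |- continuous (fun x => fst (@?f x)) =>
      apply: (continuous_comp_fun (f := f) _ (@continuous_fst _ _)); cont
  | |- continuous (fun x => snd (@?f x)) =>
      apply: (continuous_comp_fun (f := f) _ (@continuous_snd _ _)); cont
  | |- continuous (fun x => @?f x - @?g x) =>
      apply: (continuous_sub_fun (f := f) (g := g)); cont
  | |- continuous (fun x => @?f x + @?g x) =>
      apply: (continuous_add_fun (f := f) (g := g)); cont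
  | |- continuous (fun x => @?f x * @?g x) =>
      apply: (continuous_mul_fun (f := f) (g := g)); cont
  | |- continuous (fun x => Num.max (@?f x) (@?g x)) =>
      apply: (continuous_max_fun (f := f) (g := g)); cont
  | |- continuous (fun x => Num.min (@?f x) (@?g x)) =>
      apply: (continuous_min_fun (f := f) (g := g)); cont
  | H : continuous ?g |- continuous (fun x => ?g (@?f x)) =>
      apply: (continuous_comp_fun (f := f) _ H); cont
  | |- _ => try assumption
  end.

(** * Polar coordinates on the disk *)

Section polar.
Variable R : realType.
Implicit Types (t r : R) (p q : R * R).

(** Formulas on the square or on the unit interval are extended to all real
    arguments by clamping, so that continuity can be stated on the whole plane. *)
Definition clamp t : R := Num.max 0 (Num.min 1 t).

Lemma clamp_id t : 0 <= t <= 1 -> clamp t = t.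
Proof. by case/andP=> t0 t1; rewrite /clamp (min_idPr t1) (max_idPr t0). Qed.

Lemma clamp_le0 t : t <= 0 -> clamp t = 0.
Proof.
by move=> t0; rewrite /clamp (min_idPr (le_trans t0 ler01)) (max_idPl t0).
Qed.

Lemma clamp_ge1 t : 1 <= t -> clamp t = 1.
Proof. by move=> t1; rewrite /clamp (min_idPl t1) (max_idPr ler01). Qed.

Lemma clampP t : 0 <= clamp t <= 1.
Proof. by rewrite /clamp le_max lexx /= ge_max ler01 ge_min lexx. Qed.

Lemma clamp_cont : continuous clamp.
Proof. by rewrite /clamp; cont. Qed.

(** The angle is measured in turns. *)
Definition polar p : R * R :=
  (clamp p.2 * (circle_param (clamp p.1)).1,
   clamp p.2 * (circle_param (clamp p.1)).2).

Lemma polar_continuous : continuous polar.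
Proof.
have := clamp_cont; have := @circle_param_continuous R => cc kc.
by rewrite /polar; cont.
Qed.

Lemma sqnorm_scale (k : R) p : sqnorm (k * p.1, k * p.2) = k ^+ 2 * sqnorm p.
Proof. by rewrite /sqnorm /= !exprMn mulrDr. Qed.

Lemma sqnorm_polar p : sqnorm (polar p) = clamp p.2 ^+ 2.
Proof.
have := @circle_paramE R (clamp p.1).
by rewrite /circle /= sqnorm_scale => ->; rewrite mulr1.
Qed.

Lemma disk_polar p : disk (polar p).
Proof.
rewrite /disk /= sqnorm_polar; have /andP[k0 k1] := clampP p.2.
by rewrite expr_le1.
Qed.

Lemma polar_ge1 p : 1 <= p.2 -> polar p = circle_param (clamp p.1).
Proof. by move=> p1; rewrite /polar clamp_ge1// !mul1r -surjective_pairing. Qed.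

Definition direction p : R * R :=
  (p.1 / Num.sqrt (sqnorm p), p.2 / Num.sqrt (sqnorm p)).

Definition polar_inv p : R * R := (turn (direction p), Num.sqrt (sqnorm p)).

Lemma sqnorm_ge0 p : 0 <= sqnorm p.
Proof. by rewrite addr_ge0 ?sqr_ge0. Qed.

Lemma sqnorm_eq0 p : sqnorm p = 0 -> p = (0, 0).
Proof.
case: p => x y /eqP; rewrite /sqnorm /= paddr_eq0 ?sqr_ge0// !sqrf_eq0.
by case/andP=> /eqP -> /eqP ->.
Qed.

Lemma circle_direction p : sqnorm p != 0 -> circle (direction p).
Proof.
move=> p0; rewrite /circle /direction /= ![_ / _]mulrC sqnorm_scale exprVn.
by rewrite sqr_sqrtr ?sqnorm_ge0// mulVf.
Qed.

Lemma direction_polar p :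
  0 < clamp p.2 -> direction (polar p) = circle_param (clamp p.1).
Proof.
move=> r0; rewrite /direction sqnorm_polar sqrtr_sqr (ger0_norm (ltW r0)) /=.
by rewrite ![_ * _ / _]mulrAC divff ?gt_eqF// !mul1r.
Qed.

Lemma turn0 : turn (0, 0) = (4^-1 : R).
Proof.
have pi0 : pi != 0 :> R by rewrite gt_eqF ?pi_gt0.
by rewrite /turn /= lexx acos0; move: (pi : R) pi0 => q q0; field.
Qed.

Lemma polar_inv_itv p : disk p ->
  0 <= (polar_inv p).1 <= 1 /\ 0 <= (polar_inv p).2 <= 1.
Proof.
move=> dp; split=> /=.
  have [p0|p0] := eqVneq (sqnorm p) 0.
    by rewrite /direction p0 sqrtr0 invr0 !mulr0 turn0; apply/andP; split; lra.
  by have /andP[-> /ltW ->] := turn_itv (circle_direction p0).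
by rewrite sqrtr_ge0 -sqrtr1 ler_wsqrtr.
Qed.

Lemma polar_invK p : disk p -> polar (polar_inv p) = p.
Proof.
move=> dp; have [i1 i2] := polar_inv_itv dp.
rewrite /polar !clamp_id//.
have [p0|p0] := eqVneq (sqnorm p) 0.
  by rewrite /polar_inv p0 sqrtr0 !mul0r (sqnorm_eq0 p0).
have -> : circle_param (polar_inv p).1 = _ :=
  circle_param_turn (circle_direction p0).
have s0 : Num.sqrt (sqnorm p) != 0.
  by rewrite sqrtr_eq0 -ltNge lt_neqAle eq_sym p0 sqnorm_ge0.
by rewrite /direction /= ![_ * (_ / _)]mulrC !divfK// -surjective_pairing.
Qed.

(** The fibres of the polar map on the square: the origin has a whole side as
    fibre, and the two ends of the angular interval are identified. *)
Lemma polarK (W : Type) (d : R * R -> W) :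
  (forall r, d (0, r) = d (1, r)) -> (forall t, d (t, 0) = d (0, 0)) ->
  forall t r, 0 <= t <= 1 -> 0 <= r <= 1 ->
    d (polar_inv (polar (t, r))) = d (t, r).
Proof.
move=> d01 d0 t r ht hr.
have rE : (polar_inv (polar (t, r))).2 = r.
  by rewrite /= sqnorm_polar clamp_id// sqrtr_sqr ger0_norm//; case/andP: hr.
rewrite [polar_inv _]surjective_pairing rE.
have [->|r0] := eqVneq r 0; first by rewrite d0 [RHS]d0.
rewrite -[(polar_inv _).1]/(turn (direction (polar (t, r)))).
rewrite direction_polar; last first.
  by rewrite /= clamp_id// lt_neqAle eq_sym r0; case/andP: hr.
rewrite clamp_id//.
have [t1|t1] := eqVneq t 1; last first.
  rewrite circle_paramK//; case/andP: ht => -> /=.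
  by rewrite lt_neqAle t1.
by rewrite t1 -d01; congr (d (_, _)); exact: turn_circle_param1.
Qed.

End polar.

(** * Maps out of a complex *)

Section complex_topology.
Variables (R : realType) (X : complex R).
Implicit Types (f : faces X).

Lemma Skeleton_continuous : continuous (@Skeleton R X).
Proof. by apply/continuousP => U [oU _]. Qed.

Lemma char_face_inE f (p : R * R) (dp : sqnorm p < 1) :
  char_face f p = InFace f (exist _ p dp).
Proof. by rewrite /char_face insubT. Qed.

Lemma char_face_circle f (p : R * R) : circle p ->
  char_face f p = Skeleton (attach f p).
Proof. by rewrite /circle /= => p1; rewrite /char_face insubF// p1 ltxx. Qed.

Lemma char_face_continuous (T : topologicalType) (h : T -> R * R) f :
  continuous h -> (forall x, disk (h x)) ->
  continuous (fun x => char_face f (h x)).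
Proof.
move=> hc hd; apply/continuousP => U [_ /(_ f)/open_subspaceP[W oW WU]].
rewrite (_ : _ @^-1` U = h @^-1` W); first by move/continuousP: hc; exact.
apply/seteqP; split=> x /= Hx.
  suff : (W `&` @disk R) (h x) by case.
  by rewrite WU; split=> //; exact: hd.
suff : (char_face f @^-1` U `&` @disk R) (h x) by case.
by rewrite -WU; split=> //; exact: hd.
Qed.

Lemma char_face_polar_continuous f : continuous (fun p => char_face f (polar p)).
Proof.
by apply: char_face_continuous; [exact: polar_continuous|exact: disk_polar].
Qed.

(** The polar map is a continuous surjection from a compact square onto the
    disk, hence a quotient map: the disk carries the final topology. *)
Lemma open_complexP (U : set X) :
  open (@Skeleton R X @^-1` U) ->
  (forall f, open ((fun p => char_face f (polar p)) @^-1` U)) -> open U.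
Proof.
move=> oS oF; split=> // f; apply/open_subspaceP.
pose sq : set (R * R) := `[0, 1] `*` `[0, 1].
pose C : set (R * R) := (fun p => char_face f (polar p)) @^-1` (~` U).
have cC : closed C by rewrite /C preimage_setC; exact: open_closedC (oF f).
have cW : closed (@polar R @` (sq `&` C)).
  apply: (@compact_closed (R^o * R^o)%type); first exact: norm_hausdorff.
  apply: (@continuous_compact (R * R)%type).
    exact: continuous_subspaceT (@polar_continuous R).
  apply: compact_closedI => //.
  by rewrite /sq; apply: compact_setX; exact: segment_compact.
exists (~` (@polar R @` (sq `&` C))); first exact: closed_openC.
apply/seteqP; split=> p [/= Hp dp]; split=> //.
  apply: contrapT => nU; apply: Hp; exists (polar_inv p); last exact: polar_invK.
  have [i1 i2] := polar_inv_itv dp.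
  split; first by split; rewrite /= in_itv.
  by rewrite /C /= polar_invK.
by case=> q [_ +] qp; rewrite /C /= qp; exact.
Qed.

Import ArrowAsCompactOpen.

(** The product of a quotient map with the real line is a quotient map; this is
    obtained by currying, as the real line is locally compact. *)
Lemma continuous_from_complex (Z : topologicalType) (H : X * R -> Z) :
  continuous (fun x : gpoint R (skeleton1 X) * R => H (Skeleton x.1, x.2)) ->
  (forall f, continuous
     (fun x : (R * R) * R => H (char_face f (polar x.1), x.2))) ->
  continuous H.
Proof.
move=> cS cF.
have -> : H = uncurry (curry H) by apply/funext => -[].
have [cS1 cS2] := continuous_curry cS.
have cF12 f := continuous_curry (cF f).
apply: continuous_uncurry; first exact: locally_compactR.
- exact: (@norm_hausdorff _ R^o).
- apply/continuousP => O oO; apply: open_complexP.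
    by move/continuousP: cS1 => /(_ _ oO).
  by move=> f; have [/continuousP/(_ _ oO)] := cF12 f.
move=> [q|f q]; first exact: cS2.
have dq : disk (val q) by apply/ltW/(valP q).
have [_ /(_ (polar_inv (val q)))] := cF12 f.
rewrite (_ : curry _ _ = curry H (InFace f q))//.
apply/funext => s; rewrite /curry /= polar_invK//.
by rewrite /char_face valK.
Qed.

Lemma continuous_from_complex1 (Z : topologicalType) (H : X -> Z) :
  continuous (fun x => H (Skeleton x)) ->
  (forall f, continuous (fun p => H (char_face f (polar p)))) -> continuous H.
Proof.
move=> cS cF; apply/continuousP => O oO; apply: open_complexP.
  by move/continuousP: cS => /(_ _ oO).
by move=> f; move/continuousP: (cF f) => /(_ _ oO).
Qed.

End complex_topology.

Section graph_topology.
Variables (R : realType) (G : graph).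
Import ArrowAsCompactOpen.

Lemma open_graphP (U : set (gpoint R G)) :
  (forall e, open (char_edge e @^-1` U)) -> open U.
Proof.
move=> oU; suff : gpoint_op U by [].
by move=> e; apply/open_subspaceP; exists (char_edge e @^-1` U).
Qed.

Lemma continuous_from_graph (Z : topologicalType) (H : gpoint R G * R -> Z) :
  (forall v, continuous (fun s => H (Vertex R v, s))) ->
  (forall e, continuous (fun x : R * R => H (char_edge e x.1, x.2))) ->
  continuous H.
Proof.
move=> cV cE.
have -> : H = uncurry (curry H) by apply/funext => -[].
have cE12 e := continuous_curry (cE e).
apply: continuous_uncurry; first exact: locally_compactR.
- exact: (@norm_hausdorff _ R^o).
- apply/continuousP => O oO; apply: open_graphP => e.
  by have [/continuousP/(_ _ oO)] := cE12 e.
move=> [v|e t]; first exact: cV.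
have [_ /(_ (val t))] := cE12 e.
rewrite (_ : curry _ _ = curry H (InEdge e t))//.
by apply/funext => s; rewrite /curry /= /char_edge valK.
Qed.

End graph_topology.

(** * Attaching disks along homotopic loops *)

Section homotopies.
Variable R : realType.

(** Defined for all real times, so that homotopies can be composed and
    concatenated without referring to a subspace. *)
Definition homotopic_maps (T U : topologicalType) (f g : T -> U) :=
  exists H : T * R -> U,
    [/\ continuous H, forall x, H (x, 0) = f x & forall x, H (x, 1) = g x].

Lemma homotopic_maps_sym (T U : topologicalType) (f g : T -> U) :
  homotopic_maps f g -> homotopic_maps g f.
Proof.
case=> H [Hc H0 H1]; exists (fun x => H (x.1, 1 - x.2)).
by split=> [|x|x] /=; [cont|rewrite subr0|rewrite subrr].
Qed.

Lemma homotopic_maps_trans (T U : topologicalType) (f g h : T -> U) :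
  homotopic_maps f g -> homotopic_maps g h -> homotopic_maps f h.
Proof.
case=> H [Hc H0 H1] [K [Kc K0 K1]].
exists (fun x => if 2 * x.2 - 1 <= 0 then H (x.1, Num.min 1 (2 * x.2))
                 else K (x.1, 2 * x.2 - 1)).
split=> [|x|x] /=.
- apply: (@continuous_if_le R _ _ (fun x : T * R => 2 * x.2 - 1)
    (fun x => H (x.1, Num.min 1 (2 * x.2))) (fun x => K (x.1, 2 * x.2 - 1)));
    try by cont.
  move=> -[x s] /= s0; rewrite s0 K0 -H1; congr (H (_, _)).
  by rewrite min_l//; lra.
- by rewrite mulr0 ifT ?min_r// ?H0//; lra.
- by rewrite mulr1 ifF; [rewrite -K1; congr (K (_, _)); lra|apply/negP; lra].
Qed.

Definition null_homotopic_id (T : topologicalType) :=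
  exists x0 : T, homotopic_maps id (cst x0).

Lemma null_homotopic_id_contractible (T : topologicalType) :
  null_homotopic_id T -> contractible R T.
Proof.
case=> x0 [H [Hc H0 H1]]; exists x0, H; split=> //.
exact: continuous_subspaceT.
Qed.

(** T is A with a disk attached along the loop phi, the disk being parametrized
    by c in polar coordinates. The last field is the universal property of T,
    with a time parameter so that it also constructs homotopies. *)
Record disk_attachment (A T : topologicalType) (phi : R -> A) (i : A -> T)
    (c : R * R -> T) : Prop := DiskAttachment {
  da_base : continuous i;
  da_cell : continuous c;
  da_boundary : forall t r, 1 <= r -> c (t, r) = i (phi t);
  da_center : forall t r, r <= 0 -> c (t, r) = c (0, 0);
  da_period : forall r, c (0, r) = c (1, r);
  da_cover : forall x, (exists a, x = i a) \/
    exists t r, [/\ 0 <= t <= 1, 0 <= r <= 1 & x = c (t, r)];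
  da_glue : forall (Z : topologicalType) (HA : A * R -> Z)
      (d : (R * R) * R -> Z),
    continuous HA -> continuous d ->
    (forall t s, d ((t, 1), s) = HA (phi t, s)) ->
    (forall r s, d ((0, r), s) = d ((1, r), s)) ->
    (forall t s, d ((t, 0), s) = d ((0, 0), s)) ->
    exists H : T * R -> Z, [/\ continuous H,
      forall a s, H (i a, s) = HA (a, s) &
      forall t r s, 0 <= t <= 1 -> 0 <= r <= 1 ->
        H (c (t, r), s) = d ((t, r), s)] }.

Definition loop_homotopic (A : topologicalType) (phi psi : R -> A) :=
  exists K : R * R -> A, [/\ continuous K, forall t, K (t, 0) = phi t,
    forall t, K (t, 1) = psi t & forall s, K (0, s) = K (1, s)].

Section slide.
Variables (A T T' : topologicalType) (phi psi : R -> A).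
Variables (i : A -> T) (c : R * R -> T) (i' : A -> T') (c' : R * R -> T').
Hypothesis (Tda : disk_attachment phi i c) (T'da : disk_attachment psi i' c').
Variable K : R * R -> A.
Hypotheses (Kc : continuous K) (K0 : forall t, K (t, 0) = phi t)
  (K1 : forall t, K (t, 1) = psi t) (K01 : forall s, K (0, s) = K (1, s)).

(** The inner half of the disk covers the disk of T', and the outer half is a
    collar running along the homotopy from phi to psi. *)
Lemma slide_map : exists F : T -> T', [/\ continuous F, forall a, F (i a) = i' a &
  forall t r, 0 <= t <= 1 -> 0 <= r <= 1 -> F (c (t, r)) =
    if 2 * r - 1 <= 0 then c' (t, 2 * r) else i' (K (t, 2 - 2 * r))].
Proof.
have ic := da_base Tda; have ic' := da_base T'da; have cc' := da_cell T'da.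
have [||||| H [Hc HA Hd]] := @da_glue _ _ _ _ _ Tda T' (fun x => i' x.1)
  (fun x => if 2 * x.1.2 - 1 <= 0 then c' (x.1.1, 2 * x.1.2)
            else i' (K (x.1.1, 2 - 2 * x.1.2))).
- by cont.
- apply: (@continuous_if_le R _ _ (fun x : (R * R) * R => 2 * x.1.2 - 1)
    (fun x => c' (x.1.1, 2 * x.1.2)) (fun x => i' (K (x.1.1, 2 - 2 * x.1.2))));
    try by cont.
  move=> -[[t r] s] /= r0.
  rewrite (da_boundary T'da); last by lra.
  by rewrite -K1; congr (i' (K (_, _))); lra.
- move=> t s /=; rewrite ifF; last by apply/negP; lra.
  by rewrite -K0; congr (i' (K (_, _))); lra.
- by move=> r s /=; rewrite (da_period T'da) K01.
- move=> t s /=; rewrite mulr0 sub0r lerN10.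
  by rewrite (da_center T'da).
exists (fun x => H (x, 0)); split=> [|a|t r t01 r01]; [by cont|by rewrite HA|].
by rewrite Hd.
Qed.

End slide.

(** The identity of T is homotopic to a map that factors through T'. *)
Lemma null_homotopic_id_slide (A T T' : topologicalType) (phi psi : R -> A)
    (i : A -> T) (c : R * R -> T) (i' : A -> T') (c' : R * R -> T') :
  disk_attachment phi i c -> disk_attachment psi i' c' ->
  loop_homotopic phi psi -> null_homotopic_id T' -> null_homotopic_id T.
Proof.
move=> Tda T'da [K [Kc K0 K1 K01]] [x0 [H' [H'c H'0 H'1]]].
have ic := da_base Tda; have cc := da_cell Tda.
have [F [Fc FA Fd]] := slide_map Tda T'da Kc K0 K1 K01.
have [||||G [Gc GA Gd]] := @slide_map _ _ _ psi phi _ _ _ _ T'da Tda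
  (fun x => K (x.1, 1 - x.2)).
- by cont.
- by move=> t /=; rewrite subr0.
- by move=> t /=; rewrite subrr.
- by move=> s /=; rewrite K01.
have GFE t r : 0 <= t <= 1 -> 0 <= r <= 1 -> G (F (c (t, r))) =
    if 4 * r - 1 <= 0 then c (t, 4 * r)
    else i (K (t, Num.min (4 * r - 1) (2 - 2 * r))).
  move=> t01 r01; rewrite Fd//; case: ifPn => r2.
    rewrite Gd//; last by lra.
    rewrite (_ : 2 * (2 * r) = 4 * r); last by lra.
    case: ifPn => //= r4; congr (i (K (_, _))); rewrite min_l; lra.
  rewrite GA ifF; last by apply/negP; move/negP: r2; lra.
  by congr (i (K (_, _))); rewrite min_r//; move/negP: r2; lra.
(* The composite G \o F runs along K back and forth on the collar, where the
   radius is at least 1/4. The first homotopy stretches the disk by 4, and the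
   second one makes the collar run along K up to time s and back. *)
have hom1 : homotopic_maps id (G \o F).
  have [||||| H [Hc HA Hd]] := @da_glue _ _ _ _ _ Tda T (fun x => i x.1)
    (fun x => c (x.1.1, (1 + 3 * clamp x.2) * x.1.2)).
  - by cont.
  - by have := @clamp_cont R => kc; cont.
  - move=> t s /=; rewrite (da_boundary Tda)// mulr1.
    by have := clampP s; lra.
  - by move=> r s /=; rewrite (da_period Tda).
  - by move=> t s /=; rewrite mulr0 (da_center Tda).
  pose tent (r : R) := Num.min (4 * r - 1) (2 - 2 * r).
  have [||||| H1 [H1c H1A H1d]] := @da_glue _ _ _ _ _ Tda T (fun x => i x.1)
    (fun x => if 4 * x.1.2 - 1 <= 0 then c (x.1.1, 4 * x.1.2)
      else i (K (x.1.1, Num.max 0 (Num.min x.2 (tent x.1.2))))).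
  - by cont.
  - apply: (@continuous_if_le R _ _ (fun x : (R * R) * R => 4 * x.1.2 - 1)
      (fun x => c (x.1.1, 4 * x.1.2))
      (fun x => i (K (x.1.1, Num.max 0 (Num.min x.2 (tent x.1.2))))));
      rewrite /tent; try by cont.
    move=> -[[t r] s] /= r0; rewrite (da_boundary Tda); last by lra.
    by rewrite r0 -K0; congr (i (K (_, _))); rewrite max_l// !ge_min lexx orbT.
  - move=> t s /=; rewrite ifF; last by apply/negP; lra.
    rewrite -K0; congr (i (K (_, _))); rewrite max_l//.
    by rewrite /tent !ge_min; apply/orP; right; apply/orP; right; lra.
  - by move=> r s /=; rewrite (da_period Tda) K01.
  - move=> t s /=; rewrite mulr0 sub0r lerN10.
    by rewrite (da_center Tda).
  apply: (@homotopic_maps_trans _ _ _ (fun x => H1 (x, 0))).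
    exists H; split=> // x; have [[a ->]|[t [r [t01 r01 ->]]]] := da_cover Tda x.
    - by rewrite HA.
    - by rewrite Hd//= clamp_le0// mulr0 addr0 mul1r.
    - by rewrite HA H1A.
    - rewrite Hd// H1d//= clamp_ge1// (_ : 1 + 3 * 1 = 4); last by lra.
      case: ifPn => // r4; rewrite (da_boundary Tda); last by move/negP: r4; lra.
      rewrite -K0; congr (i (K (_, _))); rewrite max_l//.
      by rewrite ge_min lexx.
  exists H1; split=> // x; have [[a ->]|[t [r [t01 r01 ->]]]] := da_cover Tda x.
    by rewrite H1A /= FA GA.
  rewrite H1d//= GFE//; case: ifPn => // r4; congr (i (K (_, _))).
  rewrite -/(tent r) (@min_r _ _ 1) ?max_r// /tent.
    by rewrite le_min; move/negP: r4 => r4; apply/andP; split; lra.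
  by rewrite ge_min; case: (lerP r (1/2)) => ?; apply/orP; [left|right]; lra.
exists (G x0); apply: homotopic_maps_trans hom1 _.
exists (fun x => G (H' (F x.1, x.2))); split=> [|x|x]; first by cont.
  by rewrite H'0.
by rewrite H'1.
Qed.

End homotopies.

(** * A complex with one more face *)

Section face_attachment.
Variables (R : realType) (G : graph) (FA FX : choiceType).
Variables (attA : FA -> R * R -> gpoint R G) (attX : FX -> R * R -> gpoint R G).
Hypotheses (attAc : forall f, {within @circle R, continuous (attA f)})
  (attXc : forall f, {within @circle R, continuous (attX f)}).
Variables (f0 : FX) (inc : FA -> FX) (part : FX -> option FA).
Hypotheses (incK : pcancel inc part) (partK : ocancel part inc)
  (part0 : forall f, part f = None <-> f = f0)
  (att_inc : forall f, attX (inc f) = attA f).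

Let A := Complex attAc.
Let X := Complex attXc.

Definition subcomplex_incl (x : A) : X :=
  match x with
  | Skeleton q => @Skeleton R X q
  | InFace f q => @InFace R X (inc f) q
  end.

Lemma subcomplex_incl_char f p :
  subcomplex_incl (@char_face R A f p) = @char_face R X (inc f) p.
Proof.
by rewrite /char_face; case: insubP => [q _ _|_] //=; rewrite att_inc.
Qed.

Lemma subcomplex_incl_continuous : continuous subcomplex_incl.
Proof.
apply: continuous_from_complex1 => [|f]; first exact: (@Skeleton_continuous R X).
rewrite (_ : (fun p => _) = fun p => @char_face R X (inc f) (polar p)).
  exact: char_face_polar_continuous.
by apply/funext => p; rewrite subcomplex_incl_char.
Qed.

(** X has the faces of A and the additional face f0; part recovers the face of A
    from which a face of X comes, if any. *)
Lemma disk_attachment_face :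
  @disk_attachment R A X
    (fun t => @Skeleton R A (attX f0 (circle_param (clamp t))))
    subcomplex_incl (fun p => @char_face R X f0 (polar p)).
Proof.
have bnd t r : 1 <= r ->
    @char_face R X f0 (polar (t, r)) =
    Skeleton (attX f0 (circle_param (clamp t)) : gpoint R (skeleton1 X)).
  by move=> r1; rewrite polar_ge1// char_face_circle//; exact: circle_paramE.
split.
- exact: subcomplex_incl_continuous.
- exact: char_face_polar_continuous.
- by move=> t r r1; rewrite bnd.
- by move=> t r r0; rewrite /polar /= !(clamp_le0 r0) (clamp_le0 (lexx 0)) !mul0r.
- move=> r; rewrite /polar /= (clamp_le0 (lexx 0)) (clamp_ge1 (lexx 1)).
  by rewrite mulr0 mulr1 [2 * _]mulr_natl cos2pi sin2pi cos0 sin0.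
- case=> [q|f q]; first by left; exists (@Skeleton R A q).
  case pf : (part f) => [f'|].
    by left; exists (@InFace R A f' q); have := partK f; rewrite pf /= => ->.
  right; have := (part0 f).1 pf => ->.
  have dq : disk (val q) by apply/ltW/(valP q).
  have [i1 i2] := polar_inv_itv dq.
  exists (polar_inv (val q)).1, (polar_inv (val q)).2; split=> //.
  by rewrite -surjective_pairing polar_invK// /char_face valK.
move=> Z HA d HAc dc dHA d01 d0.
pose H (x : X * R) : Z :=
  match x.1 with
  | Skeleton q => HA (@Skeleton R A q, x.2)
  | InFace f q => if part f is Some f' then HA (@InFace R A f' q, x.2)
                  else d (polar_inv (val q), x.2)
  end.
have Hi a s : H (subcomplex_incl a, s) = HA (a, s).
  by case: a => [//|f q]; rewrite /H /= incK.
have Hd t r s : 0 <= t <= 1 -> 0 <= r <= 1 ->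
    H (@char_face R X f0 (polar (t, r)), s) = d ((t, r), s).
  move=> t01 r01; have [r1|r1] := leP 1 r.
    have -> : r = 1 by apply/eqP; rewrite eq_le r1; case/andP: r01 => _ ->.
    by rewrite bnd// /H /= dHA.
  have lt1 : sqnorm (polar (t, r)) < 1.
    by rewrite sqnorm_polar clamp_id// expr_lt1//; case/andP: r01.
  rewrite (char_face_inE _ lt1) /H /= ((part0 f0).2 erefl)/=.
  exact: (@polarK _ _ (fun p => d (p, s))).
exists H; split=> //.
apply: continuous_from_complex => [|f].
  rewrite /H /=; apply: (continuous_comp_fun (g := HA)) => //.
  apply: continuous_pair_fun; last exact: continuous_snd.
  apply: (continuous_comp_fun (g := @Skeleton R A)); first exact: continuous_fst.
  exact: Skeleton_continuous.
case pf : (part f) => [f'|].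
  have fE : f = inc f' by have := partK f; rewrite pf.
  have -> : (fun x : (R * R) * R => H (@char_face R X f (polar x.1), x.2)) =
      fun x => HA (@char_face R A f' (polar x.1), x.2).
    by apply/funext => x; rewrite fE -subcomplex_incl_char Hi.
  apply: (continuous_comp_fun (g := HA)) => //.
  apply: continuous_pair_fun; last exact: continuous_snd.
  apply: (continuous_comp_fun (g := fun p => @char_face R A f' (polar p))).
    exact: continuous_fst.
  exact: char_face_polar_continuous.
have -> : (fun x : (R * R) * R => H (@char_face R X f (polar x.1), x.2)) =
    fun x => d ((clamp x.1.1, clamp x.1.2), x.2).
  apply/funext => -[[t r] s] /=; rewrite ((part0 f).1 pf) -Hd ?clampP//.
  by rewrite /polar /= !(clamp_id (clampP _)).
by have := @clamp_cont R => kc; cont.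
Qed.

End face_attachment.

(** * Homotopies between words *)

Section words.
Variables (R : realType) (G : choiceType) (T : topologicalType).
Variable q : gpoint R (rose G) -> T.
Hypothesis qc : continuous q.
Implicit Types (u v w : word G) (l : G * bool) (M : R).

Let x0 : T := q (Vertex R (tt : vertices (rose G))).

Definition word_loop w (t : R) : T := q (spell w t).

Lemma word_loop_continuous w : continuous (word_loop w).
Proof. by apply: continuous_comp_fun; [exact: spell_continuous|exact: qc]. Qed.

Lemma word_loop_le0 w t : t <= 0 -> word_loop w t = x0.
Proof. by move=> t0; rewrite /word_loop spell0. Qed.

Lemma word_loop_ge w t : (size w)%:R <= t -> word_loop w t = x0.
Proof. by move=> t0; rewrite /word_loop spell_size. Qed.

Lemma word_loop_cat u w t : word_loop (u ++ w) t =
  if t - (size u)%:R <= 0 then word_loop u t else word_loop w (t - (size u)%:R).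
Proof.
rewrite subr_le0; elim: u t => [|l u IHu] t.
  by rewrite /= subr0; case: ifPn => // t0; rewrite !word_loop_le0.
rewrite [in LHS]/word_loop /=; case: ifPn => [t1|t1].
  by rewrite (le_trans t1) ?ler1n// /word_loop /= t1.
have := IHu (t - 1); rewrite {1}/word_loop => ->.
rewrite lerBlDr -natr1; case: ifPn => // _.
  by rewrite /word_loop /= (negbTE t1).
by rewrite opprD addrA addrAC.
Qed.

(** Homotopies of loops parametrized by an interval of arbitrary length M and
    resting at the base point outside it: concatenating words then requires no
    reparametrization. *)
Definition based_homotopic M (g h : R -> T) := exists K : R * R -> T,
  [/\ continuous K, forall t, K (t, 0) = g t, forall t, K (t, 1) = h t &
      forall t s, t <= 0 \/ M <= t -> K (t, s) = x0].

Lemma based_homotopic_refl M g : continuous g ->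
  (forall t, t <= 0 \/ M <= t -> g t = x0) -> based_homotopic M g g.
Proof. by move=> gc g0; exists (fun x => g x.1); split=> //; [cont|move=> t s /g0]. Qed.

Lemma based_homotopic_sym M g h : based_homotopic M g h -> based_homotopic M h g.
Proof.
case=> K [Kc K0 K1 Kx]; exists (fun x => K (x.1, 1 - x.2)); split=> [|t|t|t s].
- by cont.
- by rewrite subr0.
- by rewrite subrr.
- exact: Kx.
Qed.

Lemma based_homotopic_trans M g h k :
  based_homotopic M g h -> based_homotopic M h k -> based_homotopic M g k.
Proof.
case=> H [Hc H0 H1 Hx] [K [Kc K0 K1 Kx]].
exists (fun x => if 2 * x.2 - 1 <= 0 then H (x.1, 2 * x.2) else K (x.1, 2 * x.2 - 1)).
split=> [|t|t|t s tM] /=.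
- apply: (@continuous_if_le R _ _ (fun x : R * R => 2 * x.2 - 1)
    (fun x => H (x.1, 2 * x.2)) (fun x => K (x.1, 2 * x.2 - 1))); try by cont.
  move=> -[t s] /= s0; rewrite s0 K0 -H1; congr (H (_, _)); lra.
- by rewrite mulr0 ifT ?H0//; lra.
- by rewrite mulr1 ifF; [rewrite -K1; congr (K (_, _)); lra|apply/negP; lra].
- by case: ifPn => _; [exact: Hx|exact: Kx].
Qed.

Lemma based_homotopic_le M M' g h : M <= M' ->
  based_homotopic M g h -> based_homotopic M' g h.
Proof.
move=> MM' [K [Kc K0 K1 Kx]]; exists K; split=> // t s [t0|tM]; apply: Kx.
  by left.
by right; exact: le_trans tM.
Qed.

Lemma based_homotopic_scale M (k : R) g h : 0 <= k -> M <= k ->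
  based_homotopic M g h ->
  based_homotopic 1 (fun t => g (k * t)) (fun t => h (k * t)).
Proof.
move=> k0 Mk [K [Kc K0 K1 Kx]]; exists (fun x => K (k * x.1, x.2)).
split=> [|t|t|t s tM] //=; first by cont.
apply: Kx; case: tM => [t0|t1]; first by left; rewrite mulr_ge0_le0.
by right; rewrite (le_trans Mk)// ler_peMr.
Qed.

Definition word_homotopic w w' :=
  exists M, based_homotopic M (word_loop w) (word_loop w').

Lemma word_homotopic_refl w : word_homotopic w w.
Proof.
exists (size w)%:R; apply: based_homotopic_refl.
  exact: word_loop_continuous.
by move=> t [t0|tw]; [exact: word_loop_le0|exact: word_loop_ge].
Qed.

Lemma word_homotopic_sym w w' : word_homotopic w w' -> word_homotopic w' w.
Proof. by case=> M /based_homotopic_sym; exists M. Qed.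

Lemma word_homotopic_trans w1 w2 w3 :
  word_homotopic w1 w2 -> word_homotopic w2 w3 -> word_homotopic w1 w3.
Proof.
case=> M H [M' H']; exists (Num.max M M').
apply: (@based_homotopic_trans _ _ (word_loop w2)).
  by apply: based_homotopic_le H; rewrite le_max lexx.
by apply: based_homotopic_le H'; rewrite le_max lexx orbT.
Qed.

Lemma word_homotopic_cons l w w' :
  word_homotopic w w' -> word_homotopic (l :: w) (l :: w').
Proof.
case=> M [K [Kc K0 K1 Kx]]; exists (Num.max 0 M + 1).
exists (fun x => if x.1 - 1 <= 0 then q (letter_path l x.1) else K (x.1 - 1, x.2)).
split=> [|t|t|t s tM] /=.
- apply: (@continuous_if_le R _ _ (fun x : R * R => x.1 - 1)
    (fun x => q (letter_path l x.1)) (fun x => K (x.1 - 1, x.2))).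
  + by cont.
  + by have := @letter_path_continuous R G l => lc; cont.
  + by cont.
  move=> -[t s] /= t0; rewrite t0 Kx; last by left.
  by rewrite letter_path_out//; apply/orP; right; lra.
- by rewrite K0 subr_le0 /word_loop /=; case: ifP.
- by rewrite K1 subr_le0 /word_loop /=; case: ifP.
case: ifPn => t1.
  rewrite letter_path_out//; apply/orP; case: tM => [|tM]; first by left.
  right; apply: le_trans tM; rewrite lerDr le_max lexx //.
apply: Kx; case: tM => tM; [left|right]; first by lra.
by rewrite lerBrDr; apply: le_trans tM; rewrite lerD2r le_max lexx orbT.
Qed.

(** A loop may pause at the base point between two words: this makes it
    possible to concatenate homotopies between words of different lengths. *)
Lemma word_loop_pause M w v : (size w)%:R <= M ->
  based_homotopic (M + (size v)%:R) (word_loop (w ++ v))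
    (fun t => if t - M <= 0 then word_loop w t else word_loop v (t - M)).
Proof.
move=> wM; pose m (s : R) := (size w)%:R + clamp s * (M - (size w)%:R).
have mc : continuous m by rewrite /m; have := @clamp_cont R => kc; cont.
have mP s : (size w)%:R <= m s <= M.
  have /andP[k0 k1] := clampP s.
  have Mw : 0 <= M - (size w)%:R by rewrite subr_ge0.
  by rewrite /m lerDl mulr_ge0//= -lerBrDl ler_piMl.
have wc := @word_loop_continuous w; have vc := @word_loop_continuous v.
exists (fun x => if x.1 - m x.2 <= 0 then word_loop w x.1
                 else word_loop v (x.1 - m x.2)).
split=> [|t|t|t s tM] /=.
- apply: (@continuous_if_le R _ _ (fun x : R * R => x.1 - m x.2)
    (fun x => word_loop w x.1) (fun x => word_loop v (x.1 - m x.2))); try by cont.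
  move=> -[t s] /= tm; rewrite tm [RHS]word_loop_le0// word_loop_ge//.
  by have := mP s; lra.
- by rewrite word_loop_cat /m clamp_le0// mul0r addr0.
- by rewrite /m clamp_ge1// mul1r subrKC.
have := mP s; have w0 : 0 <= (size w)%:R :> R by rewrite ler0n.
have v0 : 0 <= (size v)%:R :> R by rewrite ler0n.
case: ifPn => tm mPs.
  case: tM => tM; [exact: word_loop_le0|apply: word_loop_ge; lra].
apply: word_loop_ge; case: tM => tM; last by lra.
by exfalso; move/negP: tm; apply; lra.
Qed.

Lemma word_homotopic_catr v w w' :
  word_homotopic w w' -> word_homotopic (w ++ v) (w' ++ v).
Proof.
case=> M0 H; pose M := Num.max M0 (Num.max (size w)%:R (size w')%:R).
have M0M : M0 <= M by rewrite le_max lexx.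
have wM : (size w)%:R <= M by rewrite !le_max lexx orbT.
have w'M : (size w')%:R <= M by rewrite !le_max lexx !orbT.
have M_ge0 : 0 <= M by rewrite (le_trans _ wM)// ler0n.
exists (M + (size v)%:R); apply: based_homotopic_trans (word_loop_pause v wM) _.
apply/based_homotopic_sym/(based_homotopic_trans (word_loop_pause v w'M)).
apply/based_homotopic_sym.
have [K [Kc K0 K1 Kx]] := based_homotopic_le M0M H.
have vc := @word_loop_continuous v.
exists (fun x => if x.1 - M <= 0 then K x else word_loop v (x.1 - M)).
split=> [|t|t|t s tM] /=.
- apply: (@continuous_if_le R _ _ (fun x : R * R => x.1 - M)
    K (fun x => word_loop v (x.1 - M))) => //; try by cont.
  by move=> -[t s] /= tM; rewrite tM word_loop_le0// Kx//; right; lra.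
- by rewrite K0.
- by rewrite K1.
have v0 : 0 <= (size v)%:R :> R by rewrite ler0n.
case: ifPn => tm.
  by apply: Kx; case: tM => tM; [left|right; lra].
apply: word_loop_ge; case: tM => tM; last by lra.
by exfalso; move/negP: tm; apply; lra.
Qed.

Lemma word_homotopic_ctx u v w w' :
  word_homotopic w w' -> word_homotopic (u ++ w ++ v) (u ++ w' ++ v).
Proof.
move=> /(word_homotopic_catr v) H.
by elim: u => [//|l u IHu]; exact: word_homotopic_cons.
Qed.

(** The path runs along the letter up to time 1 - s, then back. *)
Lemma word_homotopic_cancel l : word_homotopic [:: l; (l.1, ~~ l.2)] [::].
Proof.
have lc := @letter_path_continuous R G l.
have kc := @clamp_cont R.
pose m (x : R * R) : R := Num.min (1 - clamp x.2) (Num.min x.1 (2 - x.1)).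
exists 2, (fun x => q (letter_path l (m x))); rewrite /m; split=> [|t|t|t s tM] /=.
- by cont.
- rewrite clamp_le0// subr0 /word_loop /=; congr q.
  have [t1|t1] := leP t 1.
    by rewrite (@min_l _ _ t) ?min_r//; lra.
  rewrite (@min_r _ _ t) ?min_r; [|lra|lra].
  have [t2|t2] := leP (t - 1) 1.
    rewrite /letter_path /=; case: l.2 => /=; congr (char_edge _ _); lra.
  by rewrite letter_path_out//; apply/orP; left; lra.
- rewrite clamp_ge1// subrr /word_loop /= letter_path_out//.
  by rewrite ge_min lexx.
rewrite letter_path_out//; apply/orP; left.
rewrite !ge_min; apply/orP; right; apply/orP.
by case: tM => tM; [left|right; lra].
Qed.

Lemma word_homotopic_loop w w' : word_homotopic w w' ->
  loop_homotopic (fun t => word_loop w ((size w)%:R * t))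
                 (fun t => word_loop w' ((size w')%:R * t)).
Proof.
have scale u M : (size u)%:R <= M ->
    based_homotopic 1 (fun t => word_loop u ((size u)%:R * t))
                      (fun t => word_loop u (M * t)).
  move=> uM; have uc := @word_loop_continuous u; have kc := @clamp_cont R.
  pose k (s : R) := (size u)%:R + clamp s * (M - (size u)%:R).
  have kP s : (size u)%:R <= k s.
    have /andP[k0 k1] := clampP s.
    by rewrite /k lerDl mulr_ge0// subr_ge0.
  have k_ge0 s : 0 <= k s by rewrite (le_trans _ (kP s)).
  exists (fun x => word_loop u (k x.2 * x.1)).
  split=> [|t|t|t s tM] /=.
  - by rewrite /k; cont.
  - by rewrite /k clamp_le0// mul0r addr0.
  - by rewrite /k clamp_ge1// mul1r subrKC.
  case: tM => tM; first by rewrite word_loop_le0// mulr_ge0_le0.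
  by rewrite word_loop_ge// (le_trans (kP s))// ler_peMr.
case=> M0 H; pose M := Num.max M0 (Num.max (size w)%:R (size w')%:R).
have M0M : M0 <= M by rewrite le_max lexx.
have wM : (size w)%:R <= M by rewrite !le_max lexx orbT.
have w'M : (size w')%:R <= M by rewrite !le_max lexx !orbT.
have M_ge0 : 0 <= M by rewrite (le_trans _ wM)// ler0n.
have [K [Kc K0 K1 Kx]] := based_homotopic_trans (scale _ _ wM)
  (based_homotopic_trans (based_homotopic_scale M_ge0 M0M H)
     (based_homotopic_sym (scale _ _ w'M))).
by exists K; split=> // s; rewrite !Kx//; [right|left].
Qed.

End words.

(** * Changing a relator *)

Section toward.
Variable R : realType.
Implicit Types (p : R * R) (s : R).

(** The contraction of the disk along straight lines towards the point 1 of the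
    circle. Since it fixes this point, it is compatible with attachments whose
    base point is there. *)
Definition toward1 p s : R * R :=
  ((1 - clamp s) * p.1 + clamp s, (1 - clamp s) * p.2).

Lemma toward1_continuous : continuous (fun x : (R * R) * R => toward1 x.1 x.2).
Proof. by have := @clamp_cont R => kc; rewrite /toward1; cont. Qed.

Lemma disk_toward1 p s : disk p -> disk (toward1 p s).
Proof.
rewrite /disk /sqnorm /= => p1; have /andP[] := clampP s.
move: (clamp s) p1; case: p => x y k /= xy1 k0 k1.
have d0 : 0 <= 1 - (x ^+ 2 + y ^+ 2) by rewrite subr_ge0.
have k1' : 0 <= 1 - k by rewrite subr_ge0.
rewrite -subr_ge0 [X in 0 <= X](_ : _ =
  (1 - k) * (1 - (x ^+ 2 + y ^+ 2)) + k * (1 - k) * ((1 - x) ^+ 2 + y ^+ 2)).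
  apply: addr_ge0; first exact: mulr_ge0.
  by apply: mulr_ge0; [exact: mulr_ge0|rewrite addr_ge0 ?sqr_ge0].
by ring.
Qed.

Lemma toward1_0 p s : s <= 0 -> toward1 p s = p.
Proof.
move=> s0; rewrite /toward1 clamp_le0// subr0 !mul1r addr0.
by rewrite -surjective_pairing.
Qed.

Lemma toward1_1 p s : 1 <= s -> toward1 p s = (1, 0).
Proof. by move=> s0; rewrite /toward1 clamp_ge1// subrr !mul0r add0r. Qed.

Lemma toward1_id s : toward1 (1, 0) s = (1, 0).
Proof. by rewrite /toward1 mulr1 mulr0 subrK. Qed.

Lemma circle_disk p : circle p -> disk p.
Proof. by rewrite /circle /disk /= => ->. Qed.

Lemma circle_param0 : circle_param (0 : R) = (1, 0).
Proof. by rewrite /circle_param mulr0 cos0 sin0. Qed.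

Lemma circle_param1 : circle_param (1 : R) = (1, 0).
Proof. by rewrite /circle_param mulr1 [2 * _]mulr_natl cos2pi sin2pi. Qed.

Lemma spell_circle_param (G : choiceType) (w : word G) (t : R) :
  spell_circle w (circle_param (clamp t)) = spell w ((size w)%:R * t).
Proof.
rewrite /spell_circle; have n0 : 0 <= (size w)%:R :> R by rewrite ler0n.
have [t0|t0] := leP t 0.
  rewrite clamp_le0// circle_paramK ?lexx ?ltr01// mulr0 !spell0//.
  by rewrite mulr_ge0_le0.
have [t1|t1] := leP 1 t.
  rewrite clamp_ge1// turn_circle_param1 mulr0 spell0// spell_size//.
  by rewrite ler_peMr.
by rewrite clamp_id ?circle_paramK//; apply/andP; split=> //; exact: ltW.
Qed.

End toward.

Section presentations.
Variables (R : realType) (G : choiceType).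
Implicit Types (r s w : word G) (rels : seq (word G)).

Local Notation P := (presentation_complex R).

Lemma char_face_base rels (i : 'I_(size rels)) :
  @char_face R (P rels) i (1, 0) =
  Skeleton (Vertex R (tt : vertices (rose G)) : gpoint R (skeleton1 (P rels))).
Proof.
rewrite char_face_circle; last by rewrite /circle /sqnorm /= expr1n expr0n addr0.
rewrite /= -circle_param0 -[0](clamp_le0 (lexx 0)) spell_circle_param.
by rewrite mulr0 spell0.
Qed.

(** Contracting the disk towards its base point contracts its boundary loop. *)
Lemma word_homotopic_relator rels (i : 'I_(size rels)) :
  word_homotopic (@Skeleton R (P rels)) (tnth (in_tuple rels) i) [::].
Proof.
set r := tnth _ i; have [r0|r0] := eqVneq (size r) 0%N.
  rewrite (size0nil r0).
  exact: (word_homotopic_refl (@Skeleton_continuous R (P rels))).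
have n0 : 0 < (size r)%:R :> R by rewrite ltr0n lt0n.
pose n : R := (size r)%:R.
pose h (x : R * R) := toward1 (circle_param (clamp (x.1 * n^-1))) x.2.
have hd x : disk (h x) by apply/disk_toward1/circle_disk; exact: circle_paramE.
have hc : continuous h.
  have := @toward1_continuous R => tc; have := @circle_param_continuous R => pc.
  have := @clamp_cont R => kc.
  apply: (continuous_comp_fun (g := fun x : (R * R) * R => toward1 x.1 x.2)
    (f := fun x : R * R => (circle_param (clamp (x.1 * n^-1)), x.2))) => //.
  by cont.
have bnd p : circle p -> @char_face R (P rels) i p =
    Skeleton (spell_circle r p : gpoint R (skeleton1 (P rels))).
  by move=> ?; rewrite char_face_circle.
exists n, (fun x => @char_face R (P rels) i (h x)).
split=> [|t|t|t s tM] /=.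
- exact: char_face_continuous.
- rewrite /h toward1_0//= bnd; last exact: circle_paramE.
  by rewrite spell_circle_param mulrC divfK ?gt_eqF.
- by rewrite /h toward1_1//= char_face_base.
suff -> : h (t, s) = (1, 0) by rewrite char_face_base.
rewrite /h /=; case: tM => tM.
  by rewrite clamp_le0 ?circle_param0 ?toward1_id// pmulr_lle0// invr_gt0.
by rewrite clamp_ge1 ?circle_param1 ?toward1_id// ler_pdivlMr// mul1r.
Qed.

(** Both complexes are obtained from the complex of rels0 by attaching one disk,
    along the loops of the two words. *)
Lemma null_homotopic_id_relator (rels rels' rels0 : seq (word G))
    (i : 'I_(size rels)) (i' : 'I_(size rels'))
    (inc : 'I_(size rels0) -> 'I_(size rels))
    (inc' : 'I_(size rels0) -> 'I_(size rels'))
    (part : 'I_(size rels) -> option 'I_(size rels0))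
    (part' : 'I_(size rels') -> option 'I_(size rels0)) :
  pcancel inc part -> ocancel part inc -> (forall j, part j = None <-> j = i) ->
  pcancel inc' part' -> ocancel part' inc' ->
  (forall j, part' j = None <-> j = i') ->
  (forall j, tnth (in_tuple rels) (inc j) = tnth (in_tuple rels0) j) ->
  (forall j, tnth (in_tuple rels') (inc' j) = tnth (in_tuple rels0) j) ->
  word_homotopic (@Skeleton R (P rels0)) (tnth (in_tuple rels) i)
    (tnth (in_tuple rels') i') ->
  null_homotopic_id R (P rels') -> null_homotopic_id R (P rels).
Proof.
move=> iK pK p0 iK' pK' p0' relE relE'.
move=> /(word_homotopic_loop (@Skeleton_continuous R (P rels0))) wh.
have da := @disk_attachment_face R (rose G) _ _
  (fun j => spell_circle (tnth (in_tuple rels0) j))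
  (fun j => spell_circle (tnth (in_tuple rels) j))
  (fun j => @spell_circle_continuous R G (tnth (in_tuple rels0) j))
  (fun j => @spell_circle_continuous R G (tnth (in_tuple rels) j))
  i inc part iK pK p0 (fun j => congr1 (@spell_circle R G) (relE j)).
have da' := @disk_attachment_face R (rose G) _ _
  (fun j => spell_circle (tnth (in_tuple rels0) j))
  (fun j => spell_circle (tnth (in_tuple rels') j))
  (fun j => @spell_circle_continuous R G (tnth (in_tuple rels0) j))
  (fun j => @spell_circle_continuous R G (tnth (in_tuple rels') j))
  i' inc' part' iK' pK' p0' (fun j => congr1 (@spell_circle R G) (relE' j)).
apply: null_homotopic_id_slide da da' _.
case: wh => K [Kc K0 K1 K01]; exists K; split=> // t.
  by rewrite K0 /word_loop spell_circle_param.
by rewrite K1 /word_loop spell_circle_param.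
Qed.

(** The instances for the first and for the second of two relators. *)
Lemma null_homotopic_id_relator1 r r' s :
  word_homotopic (@Skeleton R (P [:: s])) r r' ->
  null_homotopic_id R (P [:: r'; s]) -> null_homotopic_id R (P [:: r; s]).
Proof.
pose part (j : 'I_2) : option 'I_1 := if j == ord0 then None else Some ord0.
have iK : pcancel (fun=> ord_max : 'I_2) part by move=> j; rewrite [j]ord1.
have pK : ocancel part (fun=> ord_max : 'I_2).
  by case=> [[|[|//]]] j2; rewrite /part /=//; apply: val_inj.
have p0 j : part j = None <-> j = ord0 by rewrite /part; case: eqP; split.
apply: (@null_homotopic_id_relator [:: r; s] [:: r'; s] [:: s] ord0 ord0 _ _ _ _
  iK pK p0 iK pK p0).
  by move=> j; rewrite [j]ord1.
by move=> j; rewrite [j]ord1.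
Qed.

Lemma null_homotopic_id_relator2 r r' s :
  word_homotopic (@Skeleton R (P [:: s])) r r' ->
  null_homotopic_id R (P [:: s; r']) -> null_homotopic_id R (P [:: s; r]).
Proof.
pose part (j : 'I_2) : option 'I_1 := if j == ord_max then None else Some ord0.
have iK : pcancel (fun=> ord0 : 'I_2) part by move=> j; rewrite [j]ord1.
have pK : ocancel part (fun=> ord0 : 'I_2).
  by case=> [[|[|//]]] j2; rewrite /part /=//; apply: val_inj.
have p0 j : part j = None <-> j = ord_max by rewrite /part; case: eqP; split.
apply: (@null_homotopic_id_relator [:: s; r] [:: s; r'] [:: s] ord_max ord_max _ _ _ _
  iK pK p0 iK pK p0).
  by move=> j; rewrite [j]ord1.
by move=> j; rewrite [j]ord1.
Qed.

End presentations.

(** * Contractibility *)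

Section one_letter_relators.
Variables (R : realType) (G : choiceType) (rels : seq (word G)).
Variables (face : G -> 'I_(size rels)) (sign : G -> bool).
Hypotheses (faceE : forall g, tnth (in_tuple rels) (face g) = [:: (g, sign g)])
  (face_surj : forall i, exists g, i = face g).

Let X := presentation_complex R rels.
Let base : X :=
  Skeleton (Vertex R (tt : vertices (rose G)) : gpoint R (skeleton1 X)).

Let angle g (t : R) := if sign g then 1 - t else t.

Let angleK g t : angle g (angle g t) = t.
Proof. by rewrite /angle; case: (sign g) => //; rewrite opprB addrC subrK. Qed.

Definition wedge_contraction (x : X * R) : X :=
  match x.1 with
  | Skeleton (Vertex _) => base
  | Skeleton (InEdge g t) =>
      @char_face R X (face g) (toward1 (circle_param (clamp (angle g (val t)))) x.2)
  | InFace i p => @char_face R X i (toward1 (val p) x.2)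
  end.

Lemma wedge_contraction_edge g t s :
  wedge_contraction
    (Skeleton (@char_edge R (rose G) g t : gpoint R (skeleton1 X)), s) =
  @char_face R X (face g) (toward1 (circle_param (clamp (angle g t))) s).
Proof.
have out : t <= 0 \/ 1 <= t -> circle_param (clamp (angle g t)) = (1, 0).
  rewrite /angle => -[t0|t1]; case: (sign g).
  - by rewrite clamp_ge1 ?circle_param1//; lra.
  - by rewrite clamp_le0 ?circle_param0.
  - by rewrite clamp_le0 ?circle_param0//; lra.
  - by rewrite clamp_ge1 ?circle_param1.
rewrite /char_edge; case: insubP => [u _ <-//|].
rewrite negb_and -!leNgt => /orP tP.
by rewrite out// toward1_id char_face_base.
Qed.

Lemma face_boundary g t :
  @char_face R X (face g) (circle_param (clamp t)) =
  Skeleton (@char_edge R (rose G) g (angle g t) : gpoint R (skeleton1 X)).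
Proof.
rewrite char_face_circle; last exact: circle_paramE.
rewrite /= faceE spell_circle_param /= mul1r; case: ifPn => // t1.
rewrite -(@letter_path_out R G (g, sign g) t)//.
by apply/orP; right; move: t1; rewrite -ltNge => /ltW.
Qed.

Lemma wedge_contraction_face i p s : disk p ->
  wedge_contraction (@char_face R X i p, s) = @char_face R X i (toward1 p s).
Proof.
rewrite /disk /= le_eqVlt => /predU1P[cp|lt1]; last first.
  by rewrite (char_face_inE _ lt1) /wedge_contraction.
have [g ->] := face_surj i.
have /andP[t0 /ltW t1] := turn_itv cp.
rewrite -(circle_param_turn cp) -[turn p](@clamp_id R) ?t0 ?t1//.
by rewrite face_boundary wedge_contraction_edge angleK.
Qed.

(** Each face contracts to its base point, carrying along the edge that bounds
    it. *)
Lemma null_homotopic_id_one_letter : null_homotopic_id R X.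
Proof.
have tc := @toward1_continuous R; have kc := @clamp_cont R.
have cc := @circle_param_continuous R; have pc := @polar_continuous R.
exists base, wedge_contraction; split.
- apply: continuous_from_complex => [|i].
    apply: continuous_from_graph => [v|g].
      by rewrite /wedge_contraction /=; exact: continuous_const.
    rewrite (_ : (fun x => _) = fun x : R * R =>
      @char_face R X (face g) (toward1 (circle_param (clamp (angle g x.1))) x.2)).
      apply: (@char_face_continuous R X _ (fun x : R * R =>
        toward1 (circle_param (clamp (angle g x.1))) x.2)) => [|x].
        apply: (continuous_comp_fun (g := fun x : (R * R) * R => toward1 x.1 x.2)
          (f := fun x : R * R => (circle_param (clamp (angle g x.1)), x.2))) => //.
        by rewrite /angle; case: (sign g); cont.
      by apply/disk_toward1/circle_disk; exact: circle_paramE.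
    by apply/funext => x; rewrite -wedge_contraction_edge.
  rewrite (_ : (fun x => _) = fun x : (R * R) * R =>
    @char_face R X i (toward1 (polar x.1) x.2)).
    apply: (@char_face_continuous R X _ (fun x : (R * R) * R =>
      toward1 (polar x.1) x.2)) => [|x]; last by apply/disk_toward1/disk_polar.
    apply: (continuous_comp_fun (g := fun x : (R * R) * R => toward1 x.1 x.2)
      (f := fun x : (R * R) * R => (polar x.1, x.2))) => //.
    by cont.
  by apply/funext => x; rewrite wedge_contraction_face//; exact: disk_polar.
- move=> [[[]|g t]|i p]; rewrite /wedge_contraction //= toward1_0//.
    by rewrite face_boundary angleK /char_edge valK.
  by rewrite /char_face valK.
move=> [[[]|g t]|i p]; rewrite /wedge_contraction //= toward1_1//.
  exact: char_face_base.
exact: char_face_base.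
Qed.

End one_letter_relators.

Section words_in_two_letters.
Variables (R : realType).
Let G : choiceType := 'I_2.
Let a : G := 0.
Let b : G := 1.
Local Notation P := (presentation_complex R).
Local Notation A := (gen a).
Local Notation B := (gen b).
Local Notation A' := (inv_gen a).
Local Notation B' := (inv_gen b).
Local Notation "w ~[ r ] w'" :=
  (word_homotopic (@Skeleton R (P [:: r])) w w') (at level 70).

Section one_relator.
Variable r : word G.

Let Sc : continuous (@Skeleton R (P [:: r])) := @Skeleton_continuous R (P [:: r]).

Lemma wh_trans w1 w2 w3 : w1 ~[r] w2 -> w2 ~[r] w3 -> w1 ~[r] w3.
Proof. exact: word_homotopic_trans. Qed.

Lemma wh_sym w1 w2 : w1 ~[r] w2 -> w2 ~[r] w1.
Proof. exact: word_homotopic_sym. Qed.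

Lemma wh_ctx u v w w' : w ~[r] w' -> u ++ w ++ v ~[r] u ++ w' ++ v.
Proof. exact: (word_homotopic_ctx Sc). Qed.

Lemma wh_relator u v : u ++ r ++ v ~[r] u ++ v.
Proof.
apply: (word_homotopic_ctx Sc u v (w := r) (w' := [::])).
exact: (@word_homotopic_relator R G [:: r] ord0).
Qed.

Lemma wh_cancel u v l : u ++ [:: l, (l.1, ~~ l.2) & v] ~[r] u ++ v.
Proof.
exact: (word_homotopic_ctx Sc u v (w' := [::]) (word_homotopic_cancel Sc l)).
Qed.

End one_relator.

(** Inserting Aa twice turns abbaB into ab.baBAA.aa. *)
Lemma abbaB_homotopic :
  [:: A; B; B; A; B'] ~[[:: B; A; B'; A'; A']] [:: A; B; A; A].
Proof.
apply: wh_trans (wh_relator _ [:: A; B] [:: A; A]).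
apply: wh_sym; apply: wh_trans (wh_cancel _ [:: A; B; B; A; B'] [::] A').
exact: (wh_cancel _ [:: A; B; B; A; B'; A'] [:: A] A').
Qed.

(** From abaa = 1 follow baa = A, then baaa = 1 and B = aaa, so that
    baBAA = ba.aaa.AA = baa = A. *)
Lemma baBAA_homotopic : [:: B; A; B'; A'; A'] ~[[:: A; B; A; A]] [:: A'].
Proof.
have baa : [:: B; A; A] ~[[:: A; B; A; A]] [:: A'].
  apply: wh_trans (wh_relator _ [:: A'] [::]).
  exact: wh_sym (wh_cancel _ [::] [:: B; A; A] A').
have baaa : [:: B; A; A; A] ~[[:: A; B; A; A]] [::].
  apply: wh_trans (wh_cancel _ [::] [::] A').
  exact: (wh_ctx [::] [:: A] baa).
have b'aaa : [:: B'] ~[[:: A; B; A; A]] [:: A; A; A].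
  apply: wh_trans (wh_cancel _ [::] [:: A; A; A] B').
  exact: wh_sym (wh_ctx [:: B'] [::] baaa).
apply: wh_trans baa.
apply: wh_trans (wh_ctx [:: B; A] [:: A'; A'] b'aaa) _.
apply: wh_trans (wh_cancel _ [:: B; A; A; A] [:: A'] A) _.
exact: (wh_cancel _ [:: B; A; A] [::] A).
Qed.

Lemma abaa_homotopic : [:: A; B; A; A] ~[[:: A']] [:: B].
Proof.
have a1 : [:: A] ~[[:: A']] [::].
  apply: wh_trans (wh_sym (wh_relator _ [:: A] [::])) _.
  exact: (wh_cancel _ [::] [::] A).
apply: wh_trans (wh_ctx [::] [:: B; A; A] a1) _.
apply: wh_trans (wh_ctx [:: B] [:: A] a1) _.
exact: (wh_ctx [:: B] [::] a1).
Qed.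

Lemma presentation_null_homotopic_id :
  null_homotopic_id R (P [:: [:: A; B; B; A; B']; [:: B; A; B'; A'; A']]).
Proof.
apply: null_homotopic_id_relator1 abbaB_homotopic _.
apply: null_homotopic_id_relator2 baBAA_homotopic _.
apply: null_homotopic_id_relator1 abaa_homotopic _.
pose face (g : G) : 'I_2 := if g == a then ord_max else ord0.
apply: (@null_homotopic_id_one_letter R G [:: [:: B]; [:: A']] face
  (fun g => g == a)).
  case=> [[|[|//]]] g2; rewrite (tnth_nth [::]) /face /=; congr [:: (_, _)].
    exact: val_inj.
  exact: val_inj.
move=> i; exists (if i == ord0 then b else a).
by case: i => [[|[|//]]] i2; apply: val_inj.
Qed.

End words_in_two_letters.

(** * Cellular maps and immersions *)

Section opens_of_complexes.
Variables (R : realType) (X : complex R).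

Lemma attach_circle_continuous (f : faces X) :
  continuous (fun t => attach f (circle_param t)).
Proof.
apply/continuousP => O oO.
have /continuousP/(_ _ oO)/open_subspaceP[W oW WO] := @attach_continuous R X f.
rewrite (_ : _ @^-1` O = @circle_param R @^-1` W).
  by move/continuousP: (@circle_param_continuous R); exact.
have cc t : circle (circle_param t : R * R) by exact: circle_paramE.
apply/seteqP; split=> t /= Ht.
  suff : (W `&` @circle R) (circle_param t) by case.
  by rewrite WO; split.
suff : (attach f @^-1` O `&` @circle R) (circle_param t) by case.
by rewrite -WO; split.
Qed.

(** The union of B with the rays of the punctured faces that end in B. *)
Definition thickening (B : set (gpoint R (skeleton1 X))) : set X :=
  [set x | match x with
    | Skeleton q => B q
    | InFace f q => sqnorm (val q) != 0 /\ B (attach f (direction (val q)))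
    end].

Lemma open_thickening B : open B -> open (thickening B).
Proof.
move=> oB; apply: open_complexP => // f.
pose O1 : set (R * R) := (fun x => clamp x.2) @^-1` `]0, +oo[.
pose O2 : set (R * R) := (fun x => attach f (circle_param (clamp x.1))) @^-1` B.
have kc := @clamp_cont R; have ac := @attach_circle_continuous f.
have oO : open (O1 `&` O2).
  apply: openI.
    have /continuousP : continuous (fun x : R * R => clamp x.2) by cont.
    by apply; exact: rray_open.
  have /continuousP :
      continuous (fun x : R * R => attach f (circle_param (clamp x.1))).
    by apply: (continuous_comp_fun (f := fun x : R * R => clamp x.1) _ ac); cont.
  by apply.
rewrite (_ : _ @^-1` _ = O1 `&` O2)//; apply/seteqP.
suff E x : thickening B (char_face f (polar x)) <-> (O1 `&` O2) x.
  by split=> x /E.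
rewrite /O1 /O2 /= in_itv /= andbT.
have /andP[r0 r1] := clampP x.2.
have [lt1|ge1] := ltP (clamp x.2) 1.
  have h1 : sqnorm (polar x) < 1 by rewrite sqnorm_polar expr_lt1.
  rewrite (char_face_inE _ h1) /thickening /= sqnorm_polar sqrf_eq0.
  rewrite lt_def r0 andbT.
  by split=> -[x0]; rewrite direction_polar// lt_def x0.
have c1 : clamp x.2 = 1 by apply/eqP; rewrite eq_le r1 ge1.
rewrite /polar c1 !mul1r -surjective_pairing
  char_face_circle; last exact: circle_paramE.
by rewrite /thickening /=; split=> [|[]//]; rewrite ltr01.
Qed.

End opens_of_complexes.

(** These are the sets that witness the continuity of the inverse homeomorphism
    from the open face d to the open face f. *)
Lemma open_face_image (R : realType) (Y X : complex R) (f : faces Y) (d : faces X)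
    (O : set Y) : open O ->
  open [set x : X | if x is InFace g q then g = d /\ O (InFace f q) else False].
Proof.
move=> oO; apply: open_complexP => [|g]; first exact: open0.
pose O1 : set (R * R) := (fun x => clamp x.2) @^-1` `]-oo, 1[.
pose O2 : set (R * R) := (fun x => char_face f (polar x)) @^-1` O.
have kc := @clamp_cont R.
have inO x : clamp x.2 < 1 -> sqnorm (polar x : R * R) < 1.
  by move=> x1; have /andP[x0 _] := clampP x.2; rewrite sqnorm_polar expr_lt1.
have oO12 : open (O1 `&` O2).
  apply: openI.
    have /continuousP : continuous (fun x : R * R => clamp x.2) by cont.
    by apply; exact: lray_open.
  by move/continuousP: (@char_face_polar_continuous R Y f); exact.
have [->|gd] := eqVneq g d; last first.
  rewrite (_ : _ @^-1` _ = set0); first exact: open0.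
  rewrite -subset0 => x /=; rewrite /char_face; case: insubP => // u _ _ [gd' _].
  by move: gd; rewrite gd' eqxx.
rewrite (_ : _ @^-1` _ = O1 `&` O2)//; apply/seteqP; split=> x /=.
  rewrite /O1 /O2 /= in_itv /= /char_face; case: insubP => // u x1 _ [_ Ou].
  split=> //; rewrite ltNge; apply/negP => k1.
  have /andP[_ k1'] := clampP x.2.
  have c1 : clamp x.2 = 1 by apply/eqP; rewrite eq_le k1' k1.
  by move: x1; rewrite sqnorm_polar c1 expr1n ltxx.
rewrite /O1 /O2 /= in_itv /= => -[/inO x1].
by rewrite !(char_face_inE _ x1).
Qed.

Lemma open_edge_image (R : realType) (H G : graph) (e : edges H) (d : edges G)
    (O : set (gpoint R H)) : open O ->
  open [set x : gpoint R G |
    if x is InEdge e' t then e' = d /\ O (InEdge e t) else False].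
Proof.
move=> oO; apply: open_graphP => e'.
have [->|ed] := eqVneq e' d; last first.
  rewrite (_ : _ @^-1` _ = set0); first exact: open0.
  rewrite -subset0 => x /=; rewrite /char_edge; case: insubP => // u _ _ [ed' _].
  by move: ed; rewrite ed' eqxx.
rewrite (_ : _ @^-1` _ = `]0, 1[ `&` (char_edge e @^-1` O)).
  apply: openI; first exact: interval_open.
  by move/continuousP: (@char_edge_continuous R H e); exact.
apply/seteqP; split=> x /=; rewrite in_itv /= /char_edge; case: insubP => //.
- by move=> u x1 _ [_ Ou]; split.
- by move=> u x1 _ [_ Ou]; split.
by move=> /negbTE -> [].
Qed.

Lemma within_continuous_openP (T U : topologicalType) (A : set T) (h : T -> U) :
  (forall O, open O -> exists2 W, open W & forall x, A x -> O (h x) <-> W x) ->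
  {within A, continuous h}.
Proof.
move=> hO; apply/continuousP => O oO; apply/open_subspaceP.
have [W oW WO] := hO _ oO; exists W => //.
by apply/seteqP; split=> x [Hx Ax]; split=> //; apply/WO.
Qed.

Section cellular_map.
Variables (R : realType) (Y X : complex R).
Variables (gv : vertices (skeleton1 Y) -> vertices (skeleton1 X))
  (ge : edges (skeleton1 Y) -> edges (skeleton1 X)) (gf : faces Y -> faces X).
Hypotheses (g_src : forall e, src (ge e) = gv (src e))
  (g_tgt : forall e, tgt (ge e) = gv (tgt e)).

Definition skeleton_map (x : gpoint R (skeleton1 Y)) : gpoint R (skeleton1 X) :=
  match x with
  | Vertex v => Vertex R (gv v)
  | InEdge e t => InEdge (ge e) t
  end.

Hypothesis g_attach : forall f p, circle p ->
  skeleton_map (attach f p) = attach (gf f) p.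

Definition complex_map (x : Y) : X :=
  match x with
  | Skeleton q => @Skeleton R X (skeleton_map q)
  | InFace f q => @InFace R X (gf f) q
  end.

Lemma skeleton_map_char e t : skeleton_map (char_edge e t) = char_edge (ge e) t.
Proof.
rewrite /char_edge; case: insubP => //= _; by case: ifP; rewrite ?g_src ?g_tgt.
Qed.

Lemma complex_map_char f p : disk p ->
  complex_map (char_face f p) = char_face (gf f) p.
Proof.
rewrite /disk /= le_eqVlt => /predU1P[cp|lt1]; last first.
  by rewrite !(char_face_inE _ lt1).
by rewrite !char_face_circle//= g_attach.
Qed.

Lemma skeleton_map_continuous : continuous skeleton_map.
Proof.
apply/continuousP => O oO; apply: open_graphP => e.
rewrite (_ : _ @^-1` _ = char_edge (ge e) @^-1` O).
  by move/continuousP: (@char_edge_continuous R _ (ge e)); exact.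
by apply/funext => t /=; rewrite /preimage /= skeleton_map_char.
Qed.

Lemma complex_map_continuous : continuous complex_map.
Proof.
apply: continuous_from_complex1 => [|f].
  apply: (continuous_comp_fun (g := @Skeleton R X)).
    exact: skeleton_map_continuous.
  exact: Skeleton_continuous.
rewrite (_ : (fun p => _) = fun p => char_face (gf f) (polar p)).
  exact: char_face_polar_continuous.
by apply/funext => p; rewrite complex_map_char//; exact: disk_polar.
Qed.

(** On an open cell the inverse sends a point to the point of the same name. Its
    continuity uses that an open set of an open edge extends, by thickening, to
    an open set of the complex. *)
Lemma complex_map_combinatorial : combinatorial complex_map.
Proof.
split; first exact: complex_map_continuous.
case=> [v|e|f].
- exists (Cell0 (gv v)) => //; split.
  + split=> [x -> //|x y|x ->]; last by exists (Skeleton (Vertex R v)).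
    by rewrite !inE /= => -> ->.
  + exact: continuous_subspaceT complex_map_continuous.
  exists (fun=> Skeleton (Vertex R v)).
    by apply: continuous_subspaceT; exact: continuous_const.
  by move=> x; rewrite inE /= => ->.
- exists (Cell1 (ge e)) => //; split.
  + split=> [_ [t _ <-]|x y|_ [t _ <-]].
    * by exists t.
    * by rewrite !inE /= => -[s _ <-] [t _ <-] [] ->.
    * by exists (Skeleton (InEdge e t)) => //; exists t.
  + exact: continuous_subspaceT complex_map_continuous.
  exists (fun x : X => if x is Skeleton (InEdge _ t) then Skeleton (InEdge e t)
                   else Skeleton (Vertex R (src e))) => /=; last first.
    by move=> x; rewrite inE /= => -[t _ <-].
  apply: within_continuous_openP => O oO.
  have oO1 : open (@Skeleton R Y @^-1` O).
    by move/continuousP: (@Skeleton_continuous R Y); exact.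
  exists (thickening [set x | if x is InEdge e' t then
      e' = ge e /\ (@Skeleton R Y @^-1` O) (InEdge e t) else False]).
    by apply: open_thickening; exact: open_edge_image.
  by move=> _ [t _ <-]; rewrite /thickening /=; split=> [|[]].
- exists (Cell2 (gf f)) => //; split.
  + split=> [_ [t _ <-]|x y|_ [t _ <-]].
    * by exists t.
    * by rewrite !inE /= => -[s _ <-] [t _ <-] [] ->.
    * by exists (InFace f t) => //; exists t.
  + exact: continuous_subspaceT complex_map_continuous.
  exists (fun x : X => if x is InFace _ t then InFace f t
                   else @char_face R Y f (1, 0)) => /=; last first.
    by move=> x; rewrite inE /= => -[t _ <-].
  apply: within_continuous_openP => O oO; eexists.
    exact: (@open_face_image R Y X f (gf f) O oO).
  by move=> _ [t _ <-] /=; split=> [|[]].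
Qed.

Hypothesis skeleton_map_inj : locally_injective skeleton_map.
Hypothesis attach_inj : forall f f' p, gf f = gf f' -> circle p ->
  attach f p = attach f' p -> f = f'.

(** Two faces meeting near a point x of the skeleton and mapped to the same
    face are equal since their rays through the same angle end at the same
    point of a neighborhood of x on which the skeleton is mapped injectively. *)
Lemma complex_map_immersion : immersion complex_map.
Proof.
split; first exact: complex_map_combinatorial.
case=> [x|f q].
  have [B Bx Binj] := skeleton_map_inj x.
  exists (thickening B°).
    apply: open_nbhs_nbhs; split; last exact: nbhs_singleton (nbhs_interior Bx).
    by apply: open_thickening; exact: open_interior.
  have sB := @interior_subset _ B.
  move=> [x1|f1 q1] [x2|f2 q2]; rewrite !inE /thickening //=.
    by move=> /sB Bx1 /sB Bx2 [] /Binj ->//; rewrite inE.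
  move=> [r0 /sB B1] [_ /sB B2] [ff qq]; rewrite -qq in B2 *.
  congr InFace; have cp := circle_direction r0.
  apply: (attach_inj ff cp); apply: Binj; rewrite ?inE//.
  by rewrite !g_attach// ff.
exists [set y : Y | if y is InFace g p then g = f /\ setT (InFace f p) else False].
  by apply: open_nbhs_nbhs; split=> //; apply: open_face_image; exact: openT.
move=> y1 y2; rewrite !inE /=; case: y1 => // f1 q1 [-> _].
by case: y2 => // f2 q2 [-> _] [] ->.
Qed.

End cellular_map.

(** * Finite complexes and coverings of the rose *)

Section finite_connected.
Variables (R : realType) (Y : complex R).

Lemma compact_finite_bigcup (T : topologicalType) (I : choiceType) (A : set I)
    (F : I -> set T) :
  finite_set A -> (forall i, compact (F i)) -> compact (\bigcup_(i in A) F i).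
Proof.
case/finite_seqP=> s -> cF; rewrite bigcup_seq; exact: bigsetU_compact.
Qed.

Lemma compact_complex :
  finite_set [set: vertices (skeleton1 Y)] ->
  finite_set [set: edges (skeleton1 Y)] -> finite_set [set: faces Y] ->
  compact [set: Y].
Proof.
move=> fV fE fF.
pose CV (v : vertices (skeleton1 Y)) : set Y := [set Skeleton (Vertex R v)].
pose CE (e : edges (skeleton1 Y)) : set Y :=
  (fun t => Skeleton (char_edge e t)) @` `[0, 1].
pose CF (f : faces Y) : set Y :=
  (fun p => char_face f (polar p)) @` (`[0, 1] `*` `[0, 1]).
have cV : compact (\bigcup_(v in setT) CV v).
  by apply: compact_finite_bigcup => // v; exact: compact_set1.
have cE : compact (\bigcup_(e in setT) CE e).
  apply: compact_finite_bigcup => // e; apply: continuous_compact.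
    apply: continuous_subspaceT; apply: (continuous_comp_fun (g := @Skeleton R Y)).
      exact: char_edge_continuous.
    exact: Skeleton_continuous.
  exact: segment_compact.
have cF : compact (\bigcup_(f in setT) CF f).
  apply: compact_finite_bigcup => // f; apply: continuous_compact.
    exact: continuous_subspaceT (@char_face_polar_continuous R Y f).
  by apply: compact_setX; exact: segment_compact.
rewrite (_ : setT = (\bigcup_(v in setT) CV v `|` \bigcup_(e in setT) CE e)
                    `|` \bigcup_(f in setT) CF f).
  by apply: compactU => //; exact: compactU.
apply/esym; rewrite -subTset => -[[v|e t]|f q] _.
- by left; left; exists v.
- left; right; exists e => //; exists (val t) => /=.
    by rewrite in_itv /=; have /andP[/ltW -> /ltW ->] := valP t.
  by rewrite /char_edge valK.
right; exists f => //; exists (polar_inv (val q)).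
  have /polar_inv_itv[] : disk (val q) by apply/ltW/(valP q).
  by rewrite /= !in_itv.
rewrite polar_invK; last by apply/ltW/(valP q).
by rewrite /char_face valK.
Qed.

Local Notation joined := (connected_component [set: Y]).

Lemma joined_path (h : R -> Y) s t : continuous h -> joined (h s) (h t).
Proof.
move=> hc; have rc : connected (range h).
  apply: connected_continuous_connected; last exact: continuous_subspaceT.
  by apply/connected_intervalP.
have hs : range h (h s) by exists s.
have ht : range h (h t) by exists t.
exact: connected_component_max hs _ rc _ ht.
Qed.

Lemma joined_edge e t :
  joined (Skeleton (Vertex R (src e)) : Y) (Skeleton (char_edge e t)).
Proof.
rewrite -(char_edge_src e (lexx 0)).
apply: (joined_path (h := fun t => Skeleton (char_edge e t))).
apply: (continuous_comp_fun (g := @Skeleton R Y)); first exact: char_edge_continuous.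
exact: Skeleton_continuous.
Qed.

(** Every point of a cell is joined to the skeleton by a path, so connectedness
    reduces to that of the graph, stated as an induction principle along edges. *)
Lemma connected_complex (v0 : vertices (skeleton1 Y)) :
  (forall P : vertices (skeleton1 Y) -> Prop, P v0 ->
    (forall e, P (src e) -> P (tgt e)) -> forall v, P v) ->
  connected [set: Y].
Proof.
move=> ind; pose y0 : Y := Skeleton (Vertex R v0).
suff all y : joined y0 y.
  rewrite (_ : setT = joined y0); first exact: component_connected.
  by apply/esym; rewrite -subTset => y _.
have jV v : joined y0 (Skeleton (Vertex R v)).
  elim/ind: v => [|e Pe]; first exact: connected_component_refl.
  rewrite -(char_edge_tgt e (lexx 1)).
  exact: connected_component_trans Pe (joined_edge e 1).
have jS x : joined y0 (Skeleton x).
  case: x => [//|e t]; apply: connected_component_trans (jV (src e)) _.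
  by have := joined_edge e (val t); rewrite /char_edge valK.
case: y => [//|f q].
have dq : disk (val q) by apply/ltW/(valP q).
have -> : InFace f q = char_face f (polar (polar_inv (val q))).
  by rewrite polar_invK// /char_face valK.
set th := (polar_inv (val q)).1; set r := (polar_inv (val q)).2.
apply: connected_component_trans
  (joined_path (h := fun s => char_face f (polar (th, s))) 1 r _).
  by rewrite polar_ge1// char_face_circle//; exact: circle_paramE.
have pc := @char_face_polar_continuous R Y f.
apply: (continuous_comp_fun (f := fun s : R => (th, s)) _ pc).
by cont.
Qed.

End finite_connected.

Lemma card_fset_setT (T : finType) : #|` fset_set [set: T]| = #|T|.
Proof.
have fT : finite_set [set: T] by exact: finite_finset.
have -> : fset_set [set: T] = seq_fset tt (enum T).
  by apply/fsetP => x; rewrite (in_fset_set fT) seq_fsetE mem_enum mem_set.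
by rewrite size_seq_fset undup_id ?enum_uniq// cardE.
Qed.

(** The covering of the rose of G with fibre V on which each generator g acts
    by act g, with all the lifts of the relators that close up. *)
Section permutation_cover.
Variables (R : realType) (G V : choiceType) (act act' : G -> V -> V).
Hypotheses (actK : forall g, cancel (act g) (act' g))
  (act'K : forall g, cancel (act' g) (act g)).
Variable rels : seq (word G).
Implicit Types (l : G * bool) (v : V) (w : word G).

Definition cover_graph : graph :=
  @Graph V (G * V)%type (fun e => e.2) (fun e => act e.1 e.2).

Definition step v l : V := if l.2 then act' l.1 v else act l.1 v.

Definition lift_letter v l (t : R) : gpoint R cover_graph :=
  if l.2 then @char_edge R cover_graph (l.1, act' l.1 v) (1 - t)
  else @char_edge R cover_graph (l.1, v) t.

Fixpoint lift_spell v w (t : R) : gpoint R cover_graph :=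
  if w is l :: w' then
    if t - 1 <= 0 then lift_letter v l t else lift_spell (step v l) w' (t - 1)
  else Vertex R (v : vertices cover_graph).

Lemma lift_letter_le0 v l t : t <= 0 ->
  lift_letter v l t = Vertex R (v : vertices cover_graph).
Proof.
rewrite /lift_letter => t0; case: l.2; last by rewrite char_edge_src.
by rewrite char_edge_tgt/= ?act'K//; lra.
Qed.

Lemma lift_letter_ge1 v l t : 1 <= t ->
  lift_letter v l t = Vertex R (step v l : vertices cover_graph).
Proof.
rewrite /lift_letter /step => t0; case: l.2; last by rewrite char_edge_tgt.
by rewrite char_edge_src//; lra.
Qed.

Lemma lift_letter_continuous v l : continuous (lift_letter v l).
Proof.
rewrite /lift_letter; case: l.2; last exact: char_edge_continuous.
have ec := @char_edge_continuous R cover_graph (l.1, act' l.1 v).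
by cont.
Qed.

Lemma lift_spell_le0 v w t : t <= 0 ->
  lift_spell v w t = Vertex R (v : vertices cover_graph).
Proof.
move=> t0; case: w => [//|l w] /=; rewrite lift_letter_le0// ifT//; lra.
Qed.

Lemma lift_spell_size v w t : (size w)%:R <= t ->
  lift_spell v w t = Vertex R (foldl step v w : vertices cover_graph).
Proof.
elim: w v t => [//|l w IHw] v t /=; rewrite -natr1 => wt; case: ifPn => t1.
  have w0 : 0 <= (size w)%:R :> R by rewrite ler0n.
  rewrite lift_letter_ge1; last by lra.
  rewrite -(IHw (step v l) (t - 1)); last by lra.
  by rewrite lift_spell_le0.
by apply: IHw; lra.
Qed.

Lemma lift_spell_continuous v w : continuous (lift_spell v w).
Proof.
elim: w v => [|l w IHw] v /=; first exact: continuous_const.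
have lc := @lift_letter_continuous v l; have sc := IHw (step v l).
apply: (@continuous_if_le R _ _ (fun t : R => t - 1) (lift_letter v l)
  (fun t => lift_spell (step v l) w (t - 1))) => //; try by cont.
by move=> t t1; rewrite t1 lift_spell_le0// lift_letter_ge1//; lra.
Qed.

Lemma step_inj l : injective (step^~ l).
Proof.
rewrite /step; case: l.2 => v v'; first by move/(can_inj (act'K l.1)).
by move/(can_inj (actK l.1)).
Qed.

(** Two lifts of a path that agree at some time agree at the start, because
    letters act by bijections. *)
Lemma lift_spell_inj v v' w t : lift_spell v w t = lift_spell v' w t -> v = v'.
Proof.
elim: w v v' t => [|l w IHw] v v' t /=; first by case.
case: ifPn => t1; last by move/IHw/step_inj.
have [t0|t0] := leP t 0; first by rewrite !lift_letter_le0// => -[].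
have [t1'|t1'] := leP 1 t.
  by rewrite !lift_letter_ge1// => -[] /step_inj.
rewrite /lift_letter /char_edge; case: l.2; case: insubP => [u _ _|].
- by case=> /(can_inj (act'K l.1)).
- by move/negP; case; apply/andP; split; lra.
- by case.
- by move/negP; case; apply/andP; split; lra.
Qed.

Definition closed_lift (x : 'I_(size rels) * V) : bool :=
  foldl step x.2 (tnth (in_tuple rels) x.1) == x.2.

Definition lift_circle (f : {x | closed_lift x}) (p : R * R) : gpoint R cover_graph :=
  let w := tnth (in_tuple rels) (val f).1 in
  lift_spell (val f).2 w ((size w)%:R * turn p).

Lemma lift_circle_continuous f : {within @circle R, continuous (lift_circle f)}.
Proof.
rewrite /lift_circle; set w := tnth _ _.
apply: (@loop_turn_continuous R _
  (fun t => lift_spell (val f).2 w ((size w)%:R * t))).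
  apply: continuous_subspaceT; have sc := @lift_spell_continuous (val f).2 w.
  by cont.
rewrite mulr0 mulr1 lift_spell_le0// lift_spell_size//.
by rewrite (eqP (valP f)).
Qed.

Definition cover_complex : complex R := Complex lift_circle_continuous.

Local Notation X := (presentation_complex R rels).

Definition cover_map : cover_complex -> X :=
  @complex_map R cover_complex X (fun=> tt) fst (fun f => (val f).1).

Definition rose_map : gpoint R cover_graph -> gpoint R (rose G) :=
  @skeleton_map R cover_complex X (fun=> tt) fst.

Lemma rose_map_lift v w t : rose_map (lift_spell v w t) = spell w t.
Proof.
elim: w v t => [//|l w IHw] v t /=; rewrite subr_le0.
case: ifPn => _; last exact: IHw.
rewrite /lift_letter /letter_path /rose_map.
by case: l.2; rewrite (@skeleton_map_char R cover_complex X).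
Qed.

(** Around a vertex, the half edges are determined by their label and their
    direction: this is where act is a bijection. *)
Lemma rose_map_locally_injective : locally_injective rose_map.
Proof.
case=> [v|e t].
  pose B : set (gpoint R cover_graph) := [set x | match x with
    | Vertex v' => v' = v
    | InEdge e t => (e.2 = v /\ val t < 2^-1) \/ (act e.1 e.2 = v /\ 2^-1 < val t)
    end].
  exists B.
    apply: open_nbhs_nbhs; split=> //; apply: open_graphP => e.
    rewrite (_ : _ @^-1` _ =
      ((fun t => e.2 = v /\ t < 2^-1) : set R) `|`
      ((fun t => act e.1 e.2 = v /\ 2^-1 < t) : set R)).
      apply: openU.
        have [ev|ev] := eqVneq e.2 v.
          rewrite (_ : (fun _ => _) = `]-oo, 2^-1[%classic); first exact: lray_open.
          by apply/seteqP; split=> t /=; rewrite in_itv /=; [case|].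
        rewrite (_ : (fun _ => _) = set0); first exact: open0.
        by apply/seteqP; split=> t //= -[] /eqP; rewrite (negbTE ev).
      have [ev|ev] := eqVneq (act e.1 e.2) v.
        rewrite (_ : (fun _ => _) = `]2^-1, +oo[%classic); first exact: rray_open.
        by apply/seteqP; split=> t /=; rewrite in_itv /= andbT; [case|].
      rewrite (_ : (fun _ => _) = set0); first exact: open0.
      by apply/seteqP; split=> t //= -[] /eqP; rewrite (negbTE ev).
    suff E t : B (@char_edge R cover_graph e t) <->
        (e.2 = v /\ t < 2^-1) \/ (act e.1 e.2 = v /\ 2^-1 < t).
      by apply/seteqP; split=> t /E.
    have [t0|t0] := leP t 0.
      rewrite char_edge_src// /B /=; split=> [->|[[]//|[_ t2]]].
        by left; split=> //; lra.
      by exfalso; lra.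
    have [t1|t1] := leP 1 t.
      rewrite char_edge_tgt// /B /=; split=> [->|[[_ t2]|[]//]].
        by right; split=> //; lra.
      by exfalso; lra.
    by rewrite /char_edge; case: insubP => [u _ <-//|]; rewrite t0 t1.
  move=> x y /set_mem + /set_mem.
  case: x => [v1|e1 t1]; case: y => [v2|e2 t2] //=.
    by move=> -> ->.
  case: e1 e2 => [g1 v1] [g2 v2] /= B1 B2 [gg tt]; rewrite -gg -tt in B2 *.
  congr InEdge; congr pair.
  case: B1 B2 => [[-> h1]|[v1E h1]] [[-> h2]|[v2E h2]] //.
  - by have := lt_trans h1 h2; rewrite ltxx.
  - by have := lt_trans h1 h2; rewrite ltxx.
  by apply: (can_inj (actK g1)); rewrite v1E.
exists [set x | if x is InEdge e' s then e' = e /\ setT (InEdge e s) else False].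
  by apply: open_nbhs_nbhs; split=> //; apply: open_edge_image; exact: openT.
move=> x y /set_mem + /set_mem.
case: x => // e1 t1 [-> _]; case: y => // e2 t2 [-> _].
by case=> ->.
Qed.

Lemma cover_map_immersion : immersion cover_map.
Proof.
apply: complex_map_immersion => //.
- by move=> f p _; exact: rose_map_lift.
- exact: rose_map_locally_injective.
move=> [[i v] iv] [[i' v'] iv'] p /= ii _; move: iv iv'; rewrite -ii => iv iv'.
rewrite /lift_circle /= => /lift_spell_inj vv; apply: val_inj => /=.
by rewrite vv.
Qed.

End permutation_cover.

(** * An immersed complex of Euler characteristic 2 *)

Section fourfold_cover.
Variable R : realType.
Let G : choiceType := 'I_2.

Definition tabulate (s : seq nat) (v : 'I_4) : 'I_4 := inZp (nth 0%N s v).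

(** The cycles (0 1 2 3) and (1 2 3), given by the lists of their values. *)
Definition act4 (g : G) : 'I_4 -> 'I_4 :=
  tabulate (nth [::] [:: [:: 1; 2; 3; 0]; [:: 0; 2; 3; 1]] (g : 'I_2))%N.

Definition act4' (g : G) : 'I_4 -> 'I_4 :=
  tabulate (nth [::] [:: [:: 3; 0; 1; 2]; [:: 0; 3; 1; 2]] (g : 'I_2))%N.

Lemma act4K g : cancel (act4 g) (act4' g).
Proof.
by case: g => [[|[|//]]] g2 [[|[|[|[|//]]]]] v4; apply: val_inj.
Qed.

Lemma act4'K g : cancel (act4' g) (act4 g).
Proof.
by case: g => [[|[|//]]] g2 [[|[|[|[|//]]]]] v4; apply: val_inj.
Qed.

Let a : G := 0.
Let b : G := 1.
Let rels : seq (word G) :=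
    [:: [:: gen a; gen b; gen b; gen a; inv_gen b];
        [:: gen b; gen a; inv_gen b; inv_gen a; inv_gen a]].

Let Y : complex R := @cover_complex R G 'I_4 act4 act4' act4'K rels.

(** abbaB closes up at all four points, baBAA at the points 2 and 3. *)
Lemma card_closed_lift :
  #|{: {x : 'I_(size rels) * 'I_4 | @closed_lift G 'I_4 act4 act4' rels x}}| = 6%N.
Proof.
rewrite card_sig -sum1_card big_mkcond /=.
pose F (i : 'I_2) (v : 'I_4) : nat :=
  if @closed_lift G 'I_4 act4 act4' rels (i, v) then 1 else 0.
rewrite (eq_bigr (fun x : 'I_2 * 'I_4 => F x.1 x.2)); last by case.
rewrite -(pair_bigA _ F) /=.
by rewrite !big_ord_recl !big_ord0.
Qed.

Lemma euler_char_fourfold : euler_char Y = 2.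
Proof.
rewrite /euler_char.
rewrite (card_fset_setT 'I_4) (card_fset_setT ('I_2 * 'I_4)%type).
rewrite (card_fset_setT {x : 'I_(size rels) * 'I_4 | closed_lift act4 act4' x}).
by rewrite card_closed_lift card_prod !card_ord.
Qed.

Lemma not_weak_nonpositive_immersions :
  ~ weak_nonpositive_immersions (presentation_complex R rels).
Proof.
move=> /(_ Y (@cover_map R G 'I_4 act4 act4' act4'K rels)).
rewrite euler_char_fourfold.
have cY : compact [set: Y].
  apply: compact_complex; [exact: (@finite_finset 'I_4)
    |exact: (@finite_finset ('I_2 * 'I_4)%type)|].
  exact: (@finite_finset {x : 'I_(size rels) * 'I_4 | closed_lift act4 act4' x}).
have nY : connected [set: Y].
  apply: (@connected_complex R Y (ord0 : 'I_4)) => P P0 PS.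
  have P1 := PS (a, (ord0 : 'I_4)) P0.
  have P2 := PS (a, _) P1.
  have P3 := PS (a, _) P2.
  by case=> [[|[|[|[|//]]]]] v4; [move: P0|move: P1|move: P2|move: P3];
    congr P; apply: val_inj.
have iY := @cover_map_immersion R G 'I_4 act4 act4' act4K act4'K rels.
by move=> /(_ cY nY iY).
Qed.

End fourfold_cover.

Theorem mainTheorem2 (R : realType) :
  let a : 'I_2 := 0 in
  let b : 'I_2 := 1 in
  let X := presentation_complex R
    [:: [:: gen a; gen b; gen b; gen a; inv_gen b];
        [:: gen b; gen a; inv_gen b; inv_gen a; inv_gen a]] in
  contractible R X /\ ~ weak_nonpositive_immersions X.
Proof.
split; last exact: not_weak_nonpositive_immersions.
exact: null_homotopic_id_contractible (presentation_null_homotopic_id R).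
Qed.
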